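(* Let $\Lambda=kQ/I$ be a bound quiver algebra and let $\mathsf{E}(\Lambda)$ be its Yoneda category. Suppose there exists a $k$-subcategory $\mathsf{E}'$ of $\mathsf{E}(\Lambda)$ which is infinite dimensional and finitely generated. Then $\Lambda$ is of infinite + global dimension and of infinite co+ global dimension; consequently $\mathsf{HH}_*^\tau(\Lambda,\Lambda)$ and $\mathsf{HH}^*_\tau(\Lambda,\Lambda)$ are infinite.
   Context: Let $k$ be a field. All modules and bimodules over $\Lambda$ are finite dimensional over $k$; $D=\mathrm{Hom}_k(-,k)$; $\otimes=\otimes_k$. Bound quiver algebra: $Q$ is a finite quiver with vertex set $Q_0$, $F$ is the ideal of $kQ$ generated by the arrows, $I$ is an admissible ideal ($F^m\subset I\subset F^2$ for some $m\ge 2$), and $\Lambda=kQ/I$. Paths are composed from right to left, so $y\Lambda x$ is spanned by the classes of paths from $x$ to $y$. For $x\in Q_0$, ${}_xk$ (resp. $k_x$) is the simple left (resp. right) $\Lambda$-module at $x$. Yoneda category $\mathsf{E}(\Lambda)$: the $k$-category with set of objects $Q_0$, morphisms from $x$ to $y$ given by $\mathrm{Ext}^*_\Lambda({}_xk,{}_yk)=\bigoplus_{n\ge0}\mathrm{Ext}^n_\Lambda({}_xk,{}_yk)$, and composition the Yoneda product. The dimension of a $k$-category is the sum of the dimensions of its morphism spaces. A $k$-subcategory is given by a subset of the objects and subspaces of the morphism spaces between them, containing the identities and closed under composition; it is finitely generated if finitely many morphisms generate all its morphisms, together with identities, under composition and $k$-linear combinations. A graded vector space $V_*$ is infinite if $V_n\neq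 0$ for infinitely many $n$. $\Lambda$ has infinite + global dimension (resp. infinite co+ global dimension) if there is a pair of vertices $(y,x)$ with $y\Lambda x\neq 0$ and $\mathrm{Tor}^\Lambda_*(k_x,{}_yk)$ infinite (resp. $y\Lambda x\ne 0$ and $\mathrm{Tor}^\Lambda_*(k_y,{}_xk)$ infinite). $\tau$-Hochschild (co)homology: $\Lambda$-bimodules are left $\Lambda\otimes\Lambda^{\mathrm{op}}$-modules, and $\mathrm{Hom}_{\Lambda-\Lambda}$ denotes bimodule morphisms. $\Omega^{m}$ is the $m$-th syzygy of bimodules taken with minimal projective resolutions ($\Omega^0=\mathrm{id}$); $\mathrm{Tr}M$ is the transpose, i.e. the cokernel of $\mathrm{Hom}(P_0,\Lambda\otimes\Lambda^{\mathrm{op}})\to\mathrm{Hom}(P_1,\Lambda\otimes\Lambda^{\mathrm{op}})$ for a minimal projective presentation $P_1\to P_0\to M\to 0$; $\tau=D\,\mathrm{Tr}$ for $\Lambda$-bimodules; $\tau_n=\tau\Omega^{n-1}$ for $n\ge1$. For a $\Lambda$-bimodule $X$ and $n\geq 1$: $\mathsf{HH}^n_\tau(\Lambda,X)=D\,\mathrm{Hom}_{\Lambda-\Lambda}(X,\tau_n\Lambda)$ and $\mathsf{HH}_n^\tau(\Lambda,X)=\mathrm{Hom}_{\Lambda-\Lambda}(DX,\tau_n\Lambda)$. *)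

(* Defs.v *)
From HB Require Import structures.
From mathcomp Require Import all_boot all_algebra all_field.
From mathcomp Require Import boolp functions.
From mathcomp Require Import freeg.

Set Implicit Arguments.
Unset Strict Implicit.
Unset Printing Implicit Defensive.

Import GRing.Theory.
Local Open Scope ring_scope.
Local Open Scope quotient_scope.

(* Modules over a ring [A] are [lmodType A]; right modules are
   [lmodType A^c].  If [A] is a [k]-algebra, the [k]-structure of an [A]-module
   is the one induced by [c |-> c%:A]. *)

Section Submodules.
Variables (R : pzRingType) (M : lmodType R) (N : submodClosed M).

Record subm := Subm { subm_val :> M; _ : subm_val \in N }.
HB.instance Definition _ := [isSub for subm_val].
HB.instance Definition _ := [Choice of subm by <:].
HB.instance Definition _ := [SubChoice_isSubLmodule of subm by <:].

Definition subm_pred : {pred M} := fun x => x \in N.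
Fact subm_pred_closed : zmod_closed subm_pred.
Proof.
split=> [|x y Nx Ny]; first exact: rpred0.
rewrite /subm_pred unfold_in -scaleN1r.
by apply: rpredD => //; apply: rpredZ.
Qed.
HB.instance Definition _ := GRing.isZmodClosed.Build M subm_pred subm_pred_closed.

Definition quotm : Type := Quotient.quot subm_pred.
HB.instance Definition _ := GRing.Zmodule.on quotm.

Definition clsm (x : M) : quotm := \pi_(Quotient.quot subm_pred) x.
Definition repm (q : quotm) : M := repr (q : Quotient.quot subm_pred).

Lemma repmK q : clsm (repm q) = q.
Proof. exact: reprK. Qed.

Lemma clsm_eqP x y : reflect (clsm x = clsm y) (x - y \in N).
Proof.
apply: (iffP idP) => [Nxy|/eqP]; last by rewrite -Quotient.idealrBE.
by apply/eqP; rewrite -Quotient.idealrBE.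
Qed.

Lemma clsm_zmod : zmod_morphism clsm.
Proof. exact: (raddfB \pi_(Quotient.quot subm_pred)). Qed.
HB.instance Definition _ := GRing.isZmodMorphism.Build M quotm clsm clsm_zmod.

Definition quotm_scale (a : R) (q : quotm) : quotm := clsm (a *: repm q).

Lemma clsm_scale a x : clsm (a *: x) = quotm_scale a (clsm x).
Proof.
by apply/clsm_eqP; rewrite -scalerBr; apply/rpredZ/clsm_eqP; rewrite repmK.
Qed.

Fact quotm_scalerA a b q :
  quotm_scale a (quotm_scale b q) = quotm_scale (a * b) q.
Proof. by rewrite -[q]repmK -!clsm_scale scalerA. Qed.
Fact quotm_scale1r : left_id 1 quotm_scale.
Proof. by move=> q; rewrite -[q]repmK -clsm_scale scale1r. Qed.
Fact quotm_scalerDr : right_distributive quotm_scale +%R.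
Proof.
move=> a q r; rewrite -[q]repmK -[r]repmK -raddfD -!clsm_scale.
by rewrite scalerDr raddfD.
Qed.
Fact quotm_scalerDl q : {morph quotm_scale^~ q : a b / a + b}.
Proof. by move=> a b; rewrite -[q]repmK -!clsm_scale scalerDl raddfD. Qed.
HB.instance Definition _ := GRing.Zmodule_isLmodule.Build R quotm
  quotm_scalerA quotm_scale1r quotm_scalerDr quotm_scalerDl.
HB.instance Definition _ :=
  GRing.isScalable.Build R M quotm _ clsm clsm_scale.
End Submodules.

Section FreeLift.
Variables (R : nzRingType) (K : choiceType) (M : lmodType R) (f : K -> M).

HB.instance Definition _ :=
  GRing.isZmodMorphism.Build {freeg K / R} M (fglift f) (lift_is_additive f).

Lemma fglift_sum (D : {freeg K / R}) :
  fglift f D = \sum_(x <- dom D) coeff x D *: f x.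
Proof.
by rewrite -{1}(freeg_sumE D) raddf_sum; apply: eq_bigr => x _; exact: liftU.
Qed.

Fact fglift_scalable : scalable (fglift f).
Proof.
move=> c D /=; rewrite [in RHS]fglift_sum scaler_sumr.
rewrite [c *: D]/(fgscale c D) raddf_sum.
by apply: eq_bigr => x _; rewrite scalerA; exact: liftU.
Qed.
HB.instance Definition _ :=
  GRing.isScalable.Build R {freeg K / R} M _ (fglift f) fglift_scalable.

Lemma fglift1 x : fglift f << x >> = f x.
Proof. by rewrite liftU scale1r. Qed.

Lemma freeg_ext (g h : {linear {freeg K / R} -> M}) :
  (forall x, g << x >> = h << x >>) -> g =1 h.
Proof.
move=> gh D; rewrite -(freeg_sumE D) !linear_sum; apply: eq_bigr => x _.
suff -> : << coeff x D *g x >> = coeff x D *: << x >> by rewrite !linearZ_LR gh.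
by apply/eqP/freeg_eqP => y; rewrite coeffZ !coeffU mul1r.
Qed.
End FreeLift.

Section KernelImage.
Variables (R : pzRingType) (U V : lmodType R) (f : {linear U -> V}).

Definition kerp : {pred U} := fun x => f x == 0.
Fact kerp_closed : submod_closed kerp.
Proof.
split=> [|a x y]; rewrite !unfold_in ?linear0 // linearP.
by move=> /eqP-> /eqP->; rewrite scaler0 addr0.
Qed.
HB.instance Definition _ := GRing.isSubmodClosed.Build R U kerp kerp_closed.

Definition imp : {pred V} := fun y => `[< exists x, f x = y >].
Fact imp_closed : submod_closed imp.
Proof.
split=> [|a _ _ /asboolP[x <-] /asboolP[y <-]].
  by apply/asboolP; exists 0; rewrite linear0.
by apply/asboolP; exists (a *: x + y); rewrite linearP.
Qed.
HB.instance Definition _ := GRing.isSubmodClosed.Build R V imp imp_closed.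

Definition kerm := subm kerp.
Definition coker := quotm imp.
End KernelImage.

Section Preimage.
Variables (R : pzRingType) (U V : lmodType R) (f : {linear U -> V}).
Variable N : submodClosed V.
Definition preimp : {pred U} := fun x => f x \in N.
Fact preimp_closed : submod_closed preimp.
Proof.
have E x : (x \in preimp) = (f x \in N) by [].
by split=> [|a x y]; rewrite !E ?linear0 ?rpred0 // => fx fy; rewrite linearP rpredD ?rpredZ.
Qed.
HB.instance Definition _ := GRing.isSubmodClosed.Build R U preimp preimp_closed.
End Preimage.

Section Corestriction.
Variables (R : pzRingType) (U V : lmodType R) (f : {linear U -> V}).
Variables (N : submodClosed V) (fN : forall x, f x \in N).
Definition corestr (x : U) : subm N := Subm (fN x).
Fact corestr_linear : linear corestr.
Proof. by move=> a x y; apply: val_inj; rewrite /= linearP. Qed.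
HB.instance Definition _ :=
  GRing.isLinear.Build R U (subm N) _ corestr corestr_linear.
End Corestriction.

Section Homology.
Variables (R : pzRingType) (U V W : lmodType R).
Variables (f : {linear U -> V}) (g : {linear V -> W}).

Definition bndp : {pred kerm g} := fun z => val z \in imp f.
Fact bndp_closed : submod_closed bndp.
Proof.
have E z : (z \in bndp) = (val z \in imp f) by [].
split=> [|a x y]; rewrite !E ?raddf0 ?rpred0 // => fx fy.
by rewrite linearP rpredD ?rpredZ.
Qed.
HB.instance Definition _ := GRing.isSubmodClosed.Build R (kerm g) bndp bndp_closed.

(* ker g / (ker g :&: im f); only used for composable maps with g \o f = 0. *)
Definition homology := quotm bndp.
End Homology.

Section Span.
Variables (R : pzRingType) (V : lmodType R) (S : V -> Prop).

Definition spanp : {pred V} :=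
  fun v => `[< forall N : submodClosed V, (forall x, S x -> x \in N) -> v \in N >].
Fact spanp_closed : submod_closed spanp.
Proof.
split=> [|a x y /asboolP Sx /asboolP Sy]; apply/asboolP => N SN.
  exact: rpred0.
by rewrite rpredD ?rpredZ ?Sx ?Sy.
Qed.
HB.instance Definition _ := GRing.isSubmodClosed.Build R V spanp spanp_closed.
End Span.

Section InducedMap.
Variables (R : pzRingType) (M M' : lmodType R).
Variables (N : submodClosed M) (N' : submodClosed M') (f : {linear M -> M'}).
Hypothesis fN : forall x, x \in N -> f x \in N'.

Definition quotm_map (q : quotm N) : quotm N' := clsm N' (f (repm q)).
Lemma quotm_map_cls x : quotm_map (clsm N x) = clsm N' (f x).
Proof. by apply/clsm_eqP; rewrite -linearB; apply/fN/clsm_eqP; rewrite repmK. Qed.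
Lemma quotm_map_linear : linear quotm_map.
Proof.
by move=> a q r; rewrite -[q]repmK -[r]repmK -linearP !quotm_map_cls !linearP.
Qed.
End InducedMap.

Definition nonzero (V : zmodType) := exists v : V, v != 0.
Definition infinite_graded (V : nat -> zmodType) :=
  forall N, exists2 n, (N <= n)%N & nonzero (V n).

Section KStructure.
Variables (k : fieldType) (A : algType k).

(* The underlying [k]-vector space of an [A]-module. *)
Definition kspace (M : lmodType A) : Type := M.
Section KSpace.
Variable M : lmodType A.
HB.instance Definition _ := GRing.Zmodule.on (kspace M).
Definition kspace_scale (c : k) (x : kspace M) : kspace M := c%:A *: (x : M).
Fact kspace_scalerA a b x :
  kspace_scale a (kspace_scale b x) = kspace_scale (a * b) x.
Proof. by rewrite /kspace_scale scalerA -scalerAl mul1r scalerA. Qed.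
Fact kspace_scale1r : left_id 1 kspace_scale.
Proof. by move=> x; rewrite /kspace_scale !scale1r. Qed.
Fact kspace_scalerDr : right_distributive kspace_scale +%R.
Proof. by move=> a x y; rewrite /kspace_scale scalerDr. Qed.
Fact kspace_scalerDl x : {morph kspace_scale^~ x : a b / a + b}.
Proof. by move=> a b; rewrite /kspace_scale scalerDl [LHS]scalerDl. Qed.
HB.instance Definition _ := GRing.Zmodule_isLmodule.Build k (kspace M)
  kspace_scalerA kspace_scale1r kspace_scalerDr kspace_scalerDl.
End KSpace.

End KStructure.

Definition fin_dim (k : fieldType) (V : lmodType k) :=
  exists (n : nat) (b : 'I_n -> V),
    forall v, exists c : 'I_n -> k, v = \sum_i c i *: b i.

Section Hom.
Variables (k : fieldType) (A : algType k) (M N : lmodType A).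

Definition homp : {pred M -> N} := fun f => `[< linear f >].
Record hom := Hom { hom_fun :> M -> N; _ : hom_fun \in homp }.
HB.instance Definition _ := [isSub for hom_fun].
HB.instance Definition _ := [Choice of hom by <:].

Fact homp_closed : zmod_closed homp.
Proof.
split=> [|f g /asboolP lf /asboolP lg]; apply/asboolP => a x y /=.
  by rewrite scaler0 addr0.
have E h1 h2 z : (h1 - h2 : M -> N) z = h1 z - h2 z by [].
by rewrite !E lf lg scalerBr opprD addrACA.
Qed.
HB.instance Definition _ := GRing.isZmodClosed.Build (M -> N) homp homp_closed.
HB.instance Definition _ := [SubChoice_isSubZmodule of hom by <:].

Lemma hom_linear (f : hom) : linear f.
Proof. exact/asboolP/(valP f). Qed.
HB.instance Definition _ (f : hom) :=
  GRing.isLinear.Build A M N _ (hom_fun f) (@hom_linear f).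

Lemma homE (f g : hom) : f =1 g -> f = g.
Proof. by move=> fg; apply/val_inj/funext. Qed.

Fact mkhom_subproof (f : {linear M -> N}) : (f : M -> N) \in homp.
Proof. by apply/asboolP => a x y; rewrite linearP. Qed.
Definition mkhom (f : {linear M -> N}) : hom := Hom (mkhom_subproof f).

Fact hom_scale_subproof (c : k) (f : hom) :
  (fun x => c%:A *: f x) \in homp.
Proof.
apply/asboolP => a x y; rewrite linearP scalerDr !scalerA.
by rewrite -scalerAl -scalerAr mul1r mulr1.
Qed.
Definition hom_scale c f : hom := Hom (hom_scale_subproof c f).

Lemma homD_E (f g : hom) x : (f + g) x = f x + g x. Proof. by []. Qed.

Lemma hom_sumE (I : Type) (r : seq I) (Q : pred I) (F : I -> hom) x :
  (\sum_(i <- r | Q i) F i) x = \sum_(i <- r | Q i) F i x.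
Proof. by elim/big_rec2: _ => // i _ y _ <-. Qed.

Fact hom_scalerA a b f : hom_scale a (hom_scale b f) = hom_scale (a * b) f.
Proof. by apply: homE => x /=; rewrite scalerA -scalerAl mul1r scalerA. Qed.
Fact hom_scale1r : left_id 1 hom_scale.
Proof. by move=> f; apply: homE => x /=; rewrite !scale1r. Qed.
Fact hom_scalerDr : right_distributive hom_scale +%R.
Proof. by move=> a f g; apply: homE => x; rewrite !homD_E /= scalerDr. Qed.
Fact hom_scalerDl f : {morph hom_scale^~ f : a b / a + b}.
Proof.
by move=> a b; apply: homE => x; rewrite homD_E /= scalerDl [LHS]scalerDl.
Qed.
HB.instance Definition _ := GRing.Zmodule_isLmodule.Build k hom
  hom_scalerA hom_scale1r hom_scalerDr hom_scalerDl.
End Hom.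

Section Pullback.
Variables (k : fieldType) (A : algType k) (P Q N : lmodType A).
Variable f : {linear P -> Q}.

Definition pullback (g : hom Q N) : hom P N := mkhom (g \o f).
Fact pullback_linear : linear pullback.
Proof. by move=> c g h; apply: homE. Qed.
HB.instance Definition _ := GRing.isLinear.Build k (hom Q N) (hom P N) _
  pullback pullback_linear.
End Pullback.

Section Resolutions.
Variables (k : fieldType) (A : algType k).

Definition projective (P : lmodType A) :=
  forall (M N : lmodType A) (g : {linear M -> N}) (f : {linear P -> N}),
    (forall y, exists x, g x = y) ->
    exists h : {linear P -> M}, forall p, g (h p) = f p.

Record proj_resolution (M : lmodType A) := ProjResolution {
  res :> nat -> lmodType A;
  diff : forall n, {linear res n.+1 -> res n};
  augm : {linear res 0 -> M};
  res_proj : forall n, projective (res n);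
  res_fin : forall n, fin_dim (kspace (res n));
  augm_surj : forall x, exists p, augm p = x;
  augm_exact : forall p, augm p = 0 <-> exists q, diff 0 q = p;
  diff_exact : forall n p, diff n p = 0 <-> exists q, diff n.+1 q = p
}.

Definition superfluous (P : lmodType A) (K : submodClosed P) :=
  forall N : submodClosed P,
    (forall p, exists2 x, x \in N & p - x \in K) -> forall p, p \in N.

Record min_resolution (M : lmodType A) := MinResolution {
  min_res :> proj_resolution M;
  augm_min : superfluous (kerp (augm min_res));
  diff_min : forall n, superfluous (kerp (diff min_res n))
}.

Arguments augm_min {M} m N _ p.
Arguments diff_min {M} m n N _ p.

Definition syzygy (M : lmodType A) (R : proj_resolution M) : lmodType A :=
  kerm (augm R).

Section Shift.
Variables (M : lmodType A) (R : min_resolution M).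

Fact shift_augm_subproof (p : R 1) : diff R 0 p \in kerp (augm R).
Proof. by apply/eqP/augm_exact; exists p. Qed.
Definition shift_augm : {linear R 1 -> syzygy R} := corestr shift_augm_subproof.

Lemma shift_augm_eq0 p : shift_augm p = 0 <-> diff R 0 p = 0.
Proof. by split=> [/(congr1 val)|d0] //; apply: val_inj. Qed.

Fact shift_augm_surj x : exists p, shift_augm p = x.
Proof.
case: x => x kx; have /augm_exact[p px] := eqP kx.
by exists p; apply: val_inj.
Qed.
Fact shift_augm_exact p : shift_augm p = 0 <-> exists q, diff R 1 q = p.
Proof. by rewrite shift_augm_eq0 diff_exact. Qed.
Fact shift_augm_min : superfluous (kerp shift_augm).
Proof.
move=> N NK; apply: (diff_min R 0) => p.
have [x Nx /eqP/shift_augm_eq0 px] := NK p; exists x => //; exact/eqP.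
Qed.

Definition syz_resolution : min_resolution (syzygy R) :=
  @MinResolution (syzygy R)
    (@ProjResolution (syzygy R) (fun n => R n.+1) (fun n => diff R n.+1)
       shift_augm (fun n => @res_proj _ R n.+1) (fun n => @res_fin _ R n.+1)
       shift_augm_surj shift_augm_exact (fun n => @diff_exact _ R n.+1))
    shift_augm_min (fun n => diff_min R n.+1).
End Shift.
End Resolutions.

Section RightDual.
Variables (k : fieldType) (A : algType k) (P : lmodType A).

(* Hom_A(P, A) with the right A-module structure (f . a)(p) = f(p) a. *)
Definition rdual : Type := hom P A^o.
HB.instance Definition _ := GRing.Zmodule.on rdual.

Fact rdual_scale_subproof (a : A^c) (f : rdual) :
  (fun p => (f p : A) * (a : A) : A^o) \in @homp k A P A^o.
Proof.
apply/asboolP => b x y; rewrite linearP mulrDl.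
by congr (_ + _); rewrite -[LHS]mulrA.
Qed.
Definition rdual_scale (a : A^c) (f : rdual) : rdual :=
  Hom (rdual_scale_subproof a f).
Fact rdual_scalerA a b f :
  rdual_scale a (rdual_scale b f) = rdual_scale (a * b) f.
Proof. by apply: homE => p /=; rewrite -mulrA. Qed.
Fact rdual_scale1r : left_id 1 rdual_scale.
Proof. by move=> f; apply: homE => p; apply: mulr1. Qed.
Fact rdual_scalerDr : right_distributive rdual_scale +%R.
Proof. by move=> a f g; apply: homE => p; apply: mulrDl. Qed.
Fact rdual_scalerDl f : {morph rdual_scale^~ f : a b / a + b}.
Proof. by move=> a b; apply: homE => p; apply: mulrDr. Qed.
HB.instance Definition _ := GRing.Zmodule_isLmodule.Build A^c rdual
  rdual_scalerA rdual_scale1r rdual_scalerDr rdual_scalerDl.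
End RightDual.

Section RightDualMap.
Variables (k : fieldType) (A : algType k) (P Q : lmodType A).
Variable f : {linear P -> Q}.

Definition rdual_map (g : rdual Q) : rdual P := pullback f g.
Fact rdual_map_linear : linear rdual_map.
Proof. by move=> c g h; apply: homE. Qed.
HB.instance Definition _ := GRing.isLinear.Build A^c (rdual Q) (rdual P) _
  rdual_map rdual_map_linear.
End RightDualMap.

(* The [k]-linear dual of an [R]-module [X], made into an [S]-module through an
   antihomomorphism [s : S -> R], by (a . phi)(x) = phi (s a . x).  Instances:
   right [A]-modules to left [A]-modules ([conv_id]), bimodules to bimodules
   ([env_swap]) and vector spaces to vector spaces ([kconv_id]). *)
Section Dual.
Variables (k : fieldType) (S : algType k) (R : nzRingType).
Variables (s : {rmorphism S -> R^c}) (X : lmodType R).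

Let act (a : S) (x : X) : X := (s a : R) *: x.

Definition dualp : {pred X -> k} := fun phi =>
  `[< (forall x y, phi (x + y) = phi x + phi y) /\
      (forall c x, phi (act c%:A x) = c * phi x) >].
Record dual := Dual { dual_fun :> X -> k; _ : dual_fun \in dualp }.
HB.instance Definition _ := [isSub for dual_fun].
HB.instance Definition _ := [Choice of dual by <:].

Fact dualp_closed : zmod_closed dualp.
Proof.
split=> [|f g /asboolP[fD fZ] /asboolP[gD gZ]]; apply/asboolP.
  by split=> [x y|c x] /=; rewrite ?addr0 ?mulr0.
have E h1 h2 z : (h1 - h2 : X -> k) z = h1 z - h2 z by [].
by split=> [x y|c x]; rewrite !E ?fD ?gD ?fZ ?gZ ?mulrBr // opprD addrACA.
Qed.
HB.instance Definition _ := GRing.isZmodClosed.Build (X -> k) dualp dualp_closed.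
HB.instance Definition _ := [SubChoice_isSubZmodule of dual by <:].

Lemma dualE (f g : dual) : f =1 g -> f = g.
Proof. by move=> fg; apply/val_inj/funext. Qed.
Lemma dual_add (phi : dual) x y : phi (x + y) = phi x + phi y.
Proof. by case: phi => phi /= /asboolP[]. Qed.
Lemma dual_act (phi : dual) c x : phi (act c%:A x) = c * phi x.
Proof. by case: phi => phi /= /asboolP[]. Qed.
Lemma dualD_E (f g : dual) x : (f + g) x = f x + g x. Proof. by []. Qed.

Lemma actM a b x : act a (act b x) = act (b * a) x.
Proof. by rewrite /act scalerA rmorphM. Qed.
Lemma actD a b x : act (a + b) x = act a x + act b x.
Proof. by rewrite /act rmorphD scalerDl. Qed.

Fact dual_scale_subproof (a : S) (phi : dual) : (fun x => phi (act a x)) \in dualp.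
Proof.
apply/asboolP; split=> [x y|c x]; first by rewrite /act scalerDr dual_add.
by rewrite -dual_act !actM -scalerAl -scalerAr mul1r mulr1.
Qed.
Definition dual_scale a phi : dual := Dual (dual_scale_subproof a phi).

Fact dual_scalerA a b phi :
  dual_scale a (dual_scale b phi) = dual_scale (a * b) phi.
Proof. by apply: dualE => x /=; rewrite actM. Qed.
Fact dual_scale1r : left_id 1 dual_scale.
Proof. by move=> phi; apply: dualE => x /=; rewrite /act rmorph1 scale1r. Qed.
Fact dual_scalerDr : right_distributive dual_scale +%R.
Proof. by move=> a f g; apply: dualE. Qed.
Fact dual_scalerDl phi : {morph dual_scale^~ phi : a b / a + b}.
Proof. by move=> a b; apply: dualE => x; rewrite dualD_E /= actD dual_add. Qed.
HB.instance Definition _ := GRing.Zmodule_isLmodule.Build S dual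
  dual_scalerA dual_scale1r dual_scalerDr dual_scalerDl.
End Dual.

Section Tau.
Variables (k : fieldType) (A : algType k).

Definition conv_id (a : A) : A^c^c := a.
HB.instance Definition _ := GRing.isZmodMorphism.Build A A^c^c conv_id
  (fun _ _ => erefl).
HB.instance Definition _ := GRing.isMonoidMorphism.Build A A^c^c conv_id
  (conj erefl (fun _ _ => erefl)).

(* The first two terms of a minimal projective resolution form a minimal
   projective presentation. *)
Definition Tr (M : lmodType A) (R : min_resolution M) : lmodType A^c :=
  coker (rdual_map (diff R 0)).

Definition tau (M : lmodType A) (R : min_resolution M) : lmodType A :=
  dual conv_id (Tr R).

(* tau (Omega^n M); [syz_resolution R] is the minimal resolution of Omega M
   obtained by shifting R. *)
Fixpoint tau_syz (n : nat) (M : lmodType A) (R : min_resolution M) : lmodType A :=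
  if n is m.+1 then tau_syz m (syz_resolution R) else tau R.

(* tau_n = tau Omega^(n-1), meaningful for n >= 1. *)
Definition taun (n : nat) (M : lmodType A) (R : min_resolution M) := tau_syz n.-1 R.
End Tau.

Section KDual.
Variable k : fieldType.
Definition kconv_id (a : k^o) : k^c := a.
HB.instance Definition _ := GRing.isZmodMorphism.Build k^o k^c kconv_id
  (fun _ _ => erefl).
HB.instance Definition _ := GRing.isMonoidMorphism.Build k^o k^c kconv_id
  (conj erefl (fun a b => mulrC a b)).
Definition kdual (V : lmodType k) := dual kconv_id V.
End KDual.

Section Ext.
Variables (k : fieldType) (A : algType k) (M : lmodType A).
Variables (P : proj_resolution M) (N : lmodType A).

Definition codiff n : {linear hom (P n) N -> hom (P n.+1) N} :=
  pullback (diff P n).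
Definition codiff_in n : {linear hom (P n.-1) N -> hom (P n) N} :=
  match n with 0 => \0 | m.+1 => codiff m end.

Definition Ext n : lmodType k := homology (codiff_in n) (codiff n).
End Ext.

Section Tensor.
Variables (k : fieldType) (A : algType k).
Variables (X : lmodType A^c) (M : lmodType A).

Definition tens_free : lmodType k := {freeg (X * M)%type / k}.
Definition pure_free (x : X) (m : M) : tens_free := << (x, m) >>.

Inductive tens_rel : tens_free -> Prop :=
| TensAddl x y m :
    tens_rel (pure_free (x + y) m - pure_free x m - pure_free y m)
| TensAddr x m n :
    tens_rel (pure_free x (m + n) - pure_free x m - pure_free x n)
| TensBal x (a : A) m :
    tens_rel (pure_free ((a : A^c) *: x) m - pure_free x (a *: m))
| TensScale (c : k) x m :
    tens_rel (pure_free x (c%:A *: m) - c *: pure_free x m).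

(* X \otimes_A M *)
Definition tens : lmodType k := quotm (spanp tens_rel).
End Tensor.

Section TensorMap.
Variables (k : fieldType) (A : algType k) (X : lmodType A^c) (M M' : lmodType A).
Variable f : {linear M -> M'}.

Definition free_map (u : tens_free X M) : tens_free X M' :=
  fglift (fun p => pure_free p.1 (f p.2)) u.
Fact free_map_linear : linear free_map.
Proof.
by move=> c u v; apply: linearP. Qed.
HB.instance Definition _ := GRing.isLinear.Build k (tens_free X M)
  (tens_free X M') _ free_map free_map_linear.

Lemma free_map_pure x m : free_map (pure_free x m) = pure_free x (f m).
Proof. exact: fglift1. Qed.

Fact free_map_rel u :
  u \in spanp (@tens_rel _ _ X M) -> free_map u \in spanp (@tens_rel _ _ X M').
Proof.
move/asboolP/(_ (preimp free_map _)); apply=> {}u ru.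
apply/asboolP => N; apply.
case: ru => [x y m|x m n|x a m|c x m].
- by rewrite 2!linearB /= !free_map_pure; apply: TensAddl.
- by rewrite 2!linearB /= !free_map_pure linearD; apply: TensAddr.
- by rewrite linearB /= !free_map_pure linearZ; apply: TensBal.
- by rewrite linearB linearZ /= !free_map_pure linearZ; apply: TensScale.
Qed.

Definition tens_map : tens X M -> tens X M' :=
  quotm_map (spanp (@tens_rel _ _ X M')) free_map.
Fact tens_map_linear : linear tens_map.
Proof. exact: quotm_map_linear free_map_rel. Qed.
HB.instance Definition _ := GRing.isLinear.Build k (tens X M) (tens X M') _
  tens_map tens_map_linear.
End TensorMap.

Section Tor.
Variables (k : fieldType) (A : algType k) (X : lmodType A^c) (M : lmodType A).
Variable P : proj_resolution M.

Definition tdiff n : {linear tens X (P n.+1) -> tens X (P n)} :=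
  tens_map (X := X) (diff P n).
Definition tdiff_out n : {linear tens X (P n) -> tens X (P n.-1)} :=
  match n with 0 => \0 | m.+1 => tdiff m end.

Definition Tor n : lmodType k := homology (tdiff n) (tdiff_out n).
End Tor.

Section DirectSum.
Variables (k : fieldType) (V : nat -> lmodType k).

Record dsum := Dsum {
  dsum_fun :> forall n, V n;
  dsum_fin : exists N, forall n, (N <= n)%N -> dsum_fun n = 0 }.

Lemma dsumE (f g : dsum) : (forall n, f n = g n) -> f = g.
Proof.
case: f g => [f f0] [g g0] /= fg.
have E : f = g by apply: functional_extensionality_dep.
by case: _ / E g0 {fg} => g0; rewrite (Prop_irrelevance f0 g0).
Qed.

HB.instance Definition _ := gen_eqMixin dsum.
HB.instance Definition _ := gen_choiceMixin dsum.

Definition dsum0 : dsum :=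
  @Dsum (fun n => 0) (ex_intro _ 0%N (fun _ _ => erefl)).
Fact dsum_add_fin (f g : dsum) :
  exists N, forall n, (N <= n)%N -> f n + g n = 0.
Proof.
have [[Nf f0] [Ng g0]] := (dsum_fin f, dsum_fin g).
by exists (maxn Nf Ng) => n; rewrite geq_max => /andP[/f0-> /g0->]; apply: addr0.
Qed.
Definition dsum_add f g := Dsum (dsum_add_fin f g).
Fact dsum_scale_fin (c : k) (f : dsum) :
  exists N, forall n, (N <= n)%N -> c *: f n = 0.
Proof. by have [N f0] := dsum_fin f; exists N => n /f0->; apply: scaler0. Qed.
Definition dsum_scale c f := Dsum (dsum_scale_fin c f).

Fact dsum_addA : associative dsum_add.
Proof. by move=> f g h; apply: dsumE => n /=; rewrite addrA. Qed.
Fact dsum_addC : commutative dsum_add.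
Proof. by move=> f g; apply: dsumE => n /=; rewrite addrC. Qed.
Fact dsum_add0 : left_id dsum0 dsum_add.
Proof. by move=> f; apply: dsumE => n /=; rewrite add0r. Qed.
Fact dsum_addN : left_inverse dsum0 (dsum_scale (-1)) dsum_add.
Proof. by move=> f; apply: dsumE => n /=; rewrite scaleN1r addNr. Qed.
HB.instance Definition _ := GRing.isZmodule.Build dsum
  dsum_addA dsum_addC dsum_add0 dsum_addN.

Fact dsum_scalerA a b f : dsum_scale a (dsum_scale b f) = dsum_scale (a * b) f.
Proof. by apply: dsumE => n /=; rewrite scalerA. Qed.
Fact dsum_scale1r : left_id 1 dsum_scale.
Proof. by move=> f; apply: dsumE => n /=; rewrite scale1r. Qed.
Fact dsum_scalerDr : right_distributive dsum_scale +%R.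
Proof. by move=> a f g; apply: dsumE => n /=; rewrite scalerDr. Qed.
Fact dsum_scalerDl f : {morph dsum_scale^~ f : a b / a + b}.
Proof. by move=> a b; apply: dsumE => n /=; rewrite scalerDl. Qed.
HB.instance Definition _ := GRing.Zmodule_isLmodule.Build k dsum
  dsum_scalerA dsum_scale1r dsum_scalerDr dsum_scalerDl.
End DirectSum.

Section Lifting.
Variables (k : fieldType) (A : algType k) (S T : lmodType A).
Variables (P : proj_resolution S) (Q : proj_resolution T).

Definition cocycle l := kerm (codiff P T l).

Lemma cocycleP l (z : cocycle l) p : val z (diff P l p) = 0.
Proof. by have /eqP/(congr1 (fun h : hom _ _ => h p)) := valP z. Qed.

(* [f] is an inhomogeneous cocycle (f_l)_l.  The family F_(l, m) : P_l -> Q_m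
   gathers in one object a chain map P -> Q of degree l - m over each of its
   homogeneous components, only finitely many of which are nonzero. *)
Definition is_lift (f : forall l, cocycle l) (F : forall l m, hom (P l) (Q m)) :=
  [/\ forall l p, augm Q (F l 0%N p) = val (f l) p,
      forall m, F 0%N m.+1 = 0,
      forall l m p, diff Q m (F l.+1 m.+1 p) = F l m (diff P l p)
    & exists N, forall l m, (N + m <= l)%N -> F l m = 0].

Lemma lift_through_image (X M N : lmodType A) (g : {linear M -> N})
    (h : {linear X -> N}) : projective X ->
  (forall p, exists m, g m = h p) ->
  exists H : {linear X -> M}, forall p, g (H p) = h p.
Proof.
move=> projX im_h.
have gI m : g m \in imp g by apply/asboolP; exists m.
have hI p : h p \in imp g by apply/asboolP/im_h.
have [|H HP] := projX _ _ (corestr gI) (corestr hI); last first.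
  by exists H => p; have /(congr1 val) := HP p.
by case=> y /[dup] /asboolP[m gm] yI; exists m; apply: val_inj.
Qed.

Lemma lift_hom l (M N : lmodType A) (g : {linear M -> N}) (h : hom (P l) N) :
  (forall p, exists m, g m = h p) ->
  {h' : hom (P l) M | (forall p, g (h' p) = h p) & h = 0 -> h' = 0}.
Proof.
move=> im_h; case: (pselect (h = 0)) => [->|nz]; first by exists 0 => // p; rewrite linear0.
suff [h' gh'] : {h' : hom (P l) M | forall p, g (h' p) = h p} by exists h'.
apply: cid; have [H HP] := lift_through_image (@res_proj _ _ _ P l) im_h.
by exists (mkhom H).
Qed.

Lemma lift_exists (f : forall l, cocycle l) N :
  (forall l, (N <= l)%N -> f l = 0) -> exists F, is_lift f F.
Proof.
move=> f0.
pose cyc m : Q m -> Prop :=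
  match m with 0 => fun q => augm Q q = 0 | m'.+1 => fun q => diff Q m' q = 0 end.
have cycP m q : @cyc m q <-> exists r, diff Q m r = q.
  by case: m q => [|m] q; [apply: augm_exact | apply: diff_exact].
pose C m (G : forall l, hom (P l) (Q m)) :=
  forall l p, @cyc m (G l (diff P l p)).
pose step m (G : {G | @C m G}) l : hom (P l) (Q m.+1) :=
  match l with
  | 0 => 0
  | l.+1 => s2val (@lift_hom l.+1 _ _ (diff Q m) (pullback (diff P l) (sval G l))
              (fun p => iffLR (cycP _ _) (svalP G l p)))
  end.
have stepE m G l p : diff Q m (@step m G l.+1 p) = sval G l (diff P l p).
  by rewrite /step; case: (lift_hom _) => /= h' ->.
have step0 m G l : sval G l = 0 -> @step m G l.+1 = 0.
  rewrite /step; case: (lift_hom _) => /= h' _ h0 G0.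
  by apply: h0; rewrite G0 raddf0.
have stepC m G : @C m.+1 (@step m G).
  case=> [|l] p /=; first by rewrite raddf0.
  rewrite stepE; have -> : diff P l (diff P l.+1 p) = 0 by apply/diff_exact; exists p.
  by rewrite raddf0.
pose init l : hom (P l) (Q 0%N) := s2val (@lift_hom l _ _ (augm Q) (val (f l))
              (fun p => augm_surj Q _)).
have initE l p : augm Q (init l p) = val (f l) p.
  by rewrite /init; case: (lift_hom _) => /= h' ->.
have init0 l : f l = 0 -> init l = 0.
  by rewrite /init; case: (lift_hom _) => /= h' _ h0 fl0; apply: h0; rewrite fl0.
have initC : @C 0%N init by move=> l p /=; rewrite initE cocycleP.
pose st := nat_rect (fun m => {G | @C m G}) (exist _ init initC)
             (fun m G => exist _ (@step m G) (stepC m G)).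
exists (fun l m => sval (st m) l); split=> //=; first by move=> l m p; apply: stepE.
exists N => l m; elim: m l => [|m IHm] [|l] //=.
- by rewrite addn0 => /f0/init0.
- by rewrite addn0 => /f0/init0.
- by rewrite addnS ltnS => /IHm/step0.
Qed.
End Lifting.

(* The Yoneda product of g and f is the class of g \o F, for F a lift of f to
   chain maps.  Representatives and lifts are chosen; the class of the product
   does not depend on these choices, by the comparison theorem.  Other sign
   conventions (by (-1)^(mn) in degrees m, n) give an isomorphic category, the
   isomorphism being the identity on objects and linear and homogeneous on
   morphisms. *)
Section Yoneda.
Variables (k : fieldType) (A : algType k) (I : finType).
Variables (S : I -> lmodType A) (P : forall x, proj_resolution (S x)).

Definition Exts x y : lmodType k := dsum (Ext (P x) (S y)).

Definition cocycle_of x y (f : Exts x y) l : cocycle (S y) (P x) l :=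
  if f l == 0 then 0 else repm (f l).

Lemma cocycle_ofK x y (f : Exts x y) l : clsm _ (cocycle_of f l) = f l.
Proof. by rewrite /cocycle_of; case: eqP => [->|_]; rewrite ?raddf0 ?repmK. Qed.

Fact lift_of_subproof x y (f : Exts x y) :
  exists F : forall l m, hom (P x l) (P y m), is_lift (cocycle_of f) F.
Proof.
have [N f0] := dsum_fin f; apply: (@lift_exists _ _ _ _ _ _ _ N) => l Nl.
by rewrite /cocycle_of f0 ?eqxx.
Qed.
Definition lift_of x y (f : Exts x y) := projT1 (cid (lift_of_subproof f)).
Lemma lift_ofP x y (f : Exts x y) : is_lift (cocycle_of f) (lift_of f).
Proof. exact: projT2 (cid (lift_of_subproof f)). Qed.

Section Product.
Variables (x y z : I) (g : Exts y z) (f : Exts x y).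

Definition prod_hom l : hom (P x l) (S z) :=
  \sum_(m < l.+1) mkhom (val (cocycle_of g m) \o lift_of f l m).
Fact prod_hom_cocycle l : prod_hom l \in kerp (codiff (P x) (S z) l).
Proof.
have [_ _ dF _] := lift_ofP f.
apply/eqP/homE => p; rewrite /= hom_sumE big1 // => m _ /=.
by rewrite -dF cocycleP.
Qed.
Definition prod_cocycle l : cocycle (S z) (P x) l := Subm (prod_hom_cocycle l).
Fact prod_fin : exists N, forall l, (N <= l)%N ->
  (clsm _ (prod_cocycle l) : Ext (P x) (S z) l) = 0.
Proof.
have [_ _ _ [Nf F0]] := lift_ofP f; have [Ng g0] := dsum_fin g.
exists (Nf + Ng)%N => l Nl; suff -> : prod_cocycle l = 0 by rewrite raddf0.
apply/val_inj/homE => p; rewrite /= hom_sumE big1 // => m _ /=.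
have [Ngm|mNg] := leqP Ng m; first by rewrite /cocycle_of g0 ?eqxx.
by rewrite F0 ?linear0 // (leq_trans _ Nl) // leq_add2l ltnW.
Qed.
Definition yoneda_comp : Exts x z := Dsum prod_fin.
End Product.

Fact augm_cocycle x : mkhom (augm (P x)) \in kerp (codiff (P x) (S x) 0).
Proof. by apply/eqP/homE => p; apply/augm_exact; exists p. Qed.
Definition yoneda_id_fun x n : Ext (P x) (S x) n :=
  match n with 0 => clsm _ (Subm (augm_cocycle x)) | _ => 0 end.
Fact yoneda_id_fin x :
  exists N, forall n, (N <= n)%N -> yoneda_id_fun x n = 0.
Proof. by exists 1%N => -[]. Qed.
Definition yoneda_id x : Exts x x := Dsum (yoneda_id_fin x).
End Yoneda.

Section Enveloping.
Variables (k : fieldType) (A : falgType k).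
Let d := \dim {:A}.

(* A \otimes A^op, as matrices of coordinates on the basis of the b_i \otimes b_j,
   where b is a basis of A; [etens a b] is a \otimes b, and the product is
   (a \otimes b)(a' \otimes b') = aa' \otimes b'b (lemma [etensM]). *)
Definition env : Type := 'M[k]_d.
HB.instance Definition _ := GRing.Lmodule.on env.

Definition bvec (i : 'I_d) : A := (vbasis {:A})`_i.
Definition etens (a b : A) : env :=
  \matrix_(i, j) (coord (vbasis {:A}) i a * coord (vbasis {:A}) j b).

Definition env_mul (u v : env) : env :=
  \sum_(p : 'I_d * 'I_d) \sum_(q : 'I_d * 'I_d)
    (u p.1 p.2 * v q.1 q.2) *: etens (bvec p.1 * bvec q.1) (bvec q.2 * bvec p.2).
Definition env_one : env := etens 1 1.

Lemma bvec_ext (V : lmodType k) (f g : A -> V) :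
  linear f -> linear g -> (forall i, f (bvec i) = g (bvec i)) -> f =1 g.
Proof.
move=> lf lg fg a; rewrite (coord_vbasis (memvf a)).
have lin0 (h : A -> V) : linear h -> h 0 = 0.
  by move=> lh; have := lh (-1) 0 0; rewrite scaler0 addr0 scaleN1r addNr.
have linZ (h : A -> V) c x : linear h -> h (c *: x) = c *: h x.
  by move=> lh; have := lh c x 0; rewrite (lin0 h lh) !addr0.
elim/big_ind: _ => [|x y fx fy|i _]; first by rewrite !lin0.
  by have := (lf 1 x y, lg 1 x y); rewrite !scale1r => -[-> ->]; rewrite fx fy.
by rewrite !linZ // fg.
Qed.

Lemma etens_linl b : linear (etens^~ b).
Proof. by move=> c x y; apply/matrixP => i j; rewrite !mxE linearP mulrDl mulrA. Qed.
Lemma etens_linr a : linear (etens a).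
Proof. by move=> c x y; apply/matrixP => i j; rewrite !mxE linearP mulrDr mulrCA. Qed.

Lemma etens_bvec i j : etens (bvec i) (bvec j) = delta_mx i j.
Proof.
apply/matrixP => i' j'; rewrite !mxE !coord_free ?(basis_free (vbasisP _)) //.
by rewrite -natrM mulnb; congr (_ && _)%:R; apply: eq_sym.
Qed.

Lemma env_basis (u : env) :
  u = \sum_(p : 'I_d * 'I_d) u p.1 p.2 *: etens (bvec p.1) (bvec p.2).
Proof.
rewrite {1}[u]matrix_sum_delta pair_bigA; apply: eq_bigr => p _ /=.
by rewrite etens_bvec.
Qed.

Lemma etens_ind (Q : env -> Prop) :
  (forall a b, Q (etens a b)) -> (forall c u v, Q u -> Q v -> Q (c *: u + v)) ->
  forall u, Q u.
Proof.
move=> Qt QD u; rewrite (env_basis u); elim/big_rec: _ => [|p v _ Qv].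
  suff -> : (0 : env) = etens 0 0 by exact: Qt.
  by apply/matrixP => i j; rewrite !mxE linear0 mul0r.
by apply: QD.
Qed.

Lemma env_mul_linl v : linear (env_mul^~ v).
Proof.
move=> c x y; rewrite /env_mul scaler_sumr -big_split; apply: eq_bigr => p _ /=.
rewrite scaler_sumr -big_split; apply: eq_bigr => q _ /=.
by rewrite scalerA -scalerDl !mxE mulrDl mulrA.
Qed.
Lemma env_mul_linr u : linear (env_mul u).
Proof.
move=> c x y; rewrite /env_mul scaler_sumr -big_split; apply: eq_bigr => p _ /=.
rewrite scaler_sumr -big_split; apply: eq_bigr => q _ /=.
by rewrite scalerA -scalerDl !mxE mulrDr mulrCA.
Qed.

Lemma env_mul_bvec i j i' j' :
  env_mul (etens (bvec i) (bvec j)) (etens (bvec i') (bvec j')) =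
  etens (bvec i * bvec i') (bvec j' * bvec j).
Proof.
have E (a b i0 j0 : 'I_d) : etens (bvec a) (bvec b) i0 j0 = ((i0, j0) == (a, b))%:R.
  by rewrite etens_bvec mxE.
rewrite /env_mul (bigD1 (i, j)) //= [X in _ + X]big1 ?addr0 => [|p np].
  rewrite (bigD1 (i', j')) //= [X in _ + X]big1 ?addr0 => [|q nq].
    by rewrite !E !eqxx mulr1 scale1r.
  by rewrite !E -surjective_pairing (negPf nq) mulr0 scale0r.
by apply: big1 => q _; rewrite !E -surjective_pairing (negPf np) mul0r scale0r.
Qed.

Lemma env_mulE a b a' b' :
  env_mul (etens a b) (etens a' b') = etens (a * a') (b' * b).
Proof.
move: a'; apply: bvec_ext => [c x y|c x y|i'].
- by rewrite etens_linl env_mul_linr.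
- by rewrite mulrDr -scalerAr etens_linl.
move: b'; apply: bvec_ext => [c x y|c x y|j'].
- by rewrite etens_linr env_mul_linr.
- by rewrite mulrDl -scalerAl etens_linr.
move: a; apply: bvec_ext => [c x y|c x y|i].
- by rewrite etens_linl env_mul_linl.
- by rewrite mulrDl -scalerAl etens_linl.
move: b; apply: bvec_ext => [c x y|c x y|j].
- by rewrite etens_linr env_mul_linl.
- by rewrite mulrDr -scalerAr etens_linr.
exact: env_mul_bvec.
Qed.

Fact env_mulA : associative env_mul.
Proof.
elim/etens_ind=> [a b|c x y IHx IHy] v w; last by rewrite !env_mul_linl IHx IHy.
elim/etens_ind: v => [a' b'|c x y IHx IHy]; last first.
  by rewrite env_mul_linl !env_mul_linr env_mul_linl IHx IHy.
elim/etens_ind: w => [a'' b''|c x y IHx IHy]; last by rewrite !env_mul_linr IHx IHy.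
by rewrite !env_mulE !mulrA.
Qed.
Fact env_mul1 : left_id env_one env_mul.
Proof.
elim/etens_ind=> [a b|c x y IHx IHy]; last by rewrite env_mul_linr IHx IHy.
by rewrite env_mulE mul1r mulr1.
Qed.
Fact env_mulr1 : right_id env_one env_mul.
Proof.
elim/etens_ind=> [a b|c x y IHx IHy]; last by rewrite env_mul_linl IHx IHy.
by rewrite env_mulE mul1r mulr1.
Qed.
Fact env_mulDl : left_distributive env_mul +%R.
Proof. by move=> x y v; have := env_mul_linl v 1 x y; rewrite !scale1r. Qed.
Fact env_mulDr : right_distributive env_mul +%R.
Proof. by move=> u x y; have := env_mul_linr u 1 x y; rewrite !scale1r. Qed.
Fact env_one_neq0 : env_one != 0.
Proof.
have coord_neq0 : exists i, coord (vbasis {:A}) i 1 != 0.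
  apply/existsP; rewrite -negb_forall; apply/negP => /forallP c0.
  have /eqP := oner_neq0 A; rewrite (coord_vbasis (memvf 1)) big1 // => i _.
  by have /eqP-> := c0 i; rewrite scale0r.
have [i ci] := coord_neq0; apply/eqP => /matrixP/(_ i i)/eqP.
by rewrite !mxE mulf_eq0 (negPf ci).
Qed.
HB.instance Definition _ := GRing.Zmodule_isNzRing.Build env
  env_mulA env_mul1 env_mulr1 env_mulDl env_mulDr env_one_neq0.
Fact env_scalerAl (c : k) (u v : env) : c *: (u * v) = (c *: u) * v.
Proof. by have := env_mul_linl v c u 0; rewrite !addr0 -[env_mul 0 v]/(0 * v) mul0r addr0. Qed.
Fact env_scalerAr (c : k) (u v : env) : c *: (u * v) = u * (c *: v).
Proof. by have := env_mul_linr u c v 0; rewrite !addr0 -[env_mul u 0]/(u * 0) mulr0 addr0. Qed.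
HB.instance Definition _ := GRing.Lmodule_isLalgebra.Build k env env_scalerAl.
HB.instance Definition _ := GRing.Lalgebra_isAlgebra.Build k env env_scalerAr.

Lemma etensM a b a' b' : etens a b * etens a' b' = etens (a * a') (b' * b).
Proof. exact: env_mulE. Qed.

(* a \otimes b |-> b \otimes a *)
Definition env_swap (u : env) : env^c := u^T.
Fact env_swap_zmod : zmod_morphism env_swap.
Proof. by move=> u v; apply/matrixP => i j; rewrite !mxE. Qed.
Lemma env_swapE a b : env_swap (etens a b) = etens b a.
Proof. by apply/matrixP => i j; rewrite !mxE mulrC. Qed.
Lemma env_swap_lin : linear (env_swap : env -> env).
Proof. by move=> c u v; apply/matrixP => i j; rewrite !mxE. Qed.
Fact env_swap_monoid : monoid_morphism env_swap.
Proof.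
split=> [|u v]; first exact: env_swapE.
rewrite -[RHS]/(env_mul (env_swap v) (env_swap u)).
elim/etens_ind: u => [a b|c x y IHx IHy]; last first.
  by rewrite [_ * _]env_mul_linl !env_swap_lin env_mul_linr -IHx -IHy.
elim/etens_ind: v => [a' b'|c x y IHx IHy]; last first.
  by rewrite [_ * _]env_mul_linr !env_swap_lin env_mul_linl -IHx -IHy.
by rewrite etensM !env_swapE env_mulE.
Qed.
HB.instance Definition _ :=
  GRing.isZmodMorphism.Build env env^c env_swap env_swap_zmod.
HB.instance Definition _ :=
  GRing.isMonoidMorphism.Build env env^c env_swap env_swap_monoid.

(* A as a bimodule: (a \otimes b) x = a x b (lemma [bimod_etens]). *)
Definition bimod : Type := A.
HB.instance Definition _ := GRing.Zmodule.on bimod.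
Definition bimod_scale (u : env) (x : bimod) : bimod :=
  \sum_(p : 'I_d * 'I_d) u p.1 p.2 *: (bvec p.1 * (x : A) * bvec p.2).

Lemma bimod_scale_linl (x : bimod) : linear (bimod_scale^~ x : env -> A).
Proof.
move=> c u v; rewrite /bimod_scale scaler_sumr -big_split; apply: eq_bigr => p _ /=.
by rewrite scalerA -scalerDl !mxE.
Qed.
Lemma bimod_scale_linr (u : env) : linear (bimod_scale u : A -> A).
Proof.
move=> c x y; rewrite /bimod_scale scaler_sumr -big_split; apply: eq_bigr => p _ /=.
by rewrite mulrDr mulrDl -scalerAr -scalerAl scalerDr !scalerA mulrC.
Qed.
Lemma bimod_etens a b (x : bimod) : bimod_scale (etens a b) x = a * (x : A) * b.
Proof.
move: a; apply: bvec_ext => [c y z|c y z|i].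
- by rewrite etens_linl bimod_scale_linl.
- by rewrite !mulrDl -!scalerAl.
move: b; apply: bvec_ext => [c y z|c y z|j].
- by rewrite etens_linr bimod_scale_linl.
- by rewrite !mulrDr -!scalerAr.
rewrite etens_bvec /bimod_scale (bigD1 (i, j)) //= big1 => [|[i' j'] np].
  by rewrite mxE !eqxx scale1r addr0.
by rewrite mxE; move: np; rewrite xpair_eqE => /negPf->; rewrite scale0r.
Qed.
Fact bimod_scalerA u v x : bimod_scale u (bimod_scale v x) = bimod_scale (u * v) x.
Proof.
elim/etens_ind: u => [a b|c y z IHy IHz]; last first.
  by rewrite [_ * _]env_mul_linl !bimod_scale_linl IHy IHz.
elim/etens_ind: v => [a' b'|c y z IHy IHz]; last first.
  by rewrite [_ * _]env_mul_linr !bimod_scale_linl bimod_scale_linr IHy IHz.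
by rewrite etensM !bimod_etens !mulrA.
Qed.
Fact bimod_scale1r : left_id 1 bimod_scale.
Proof. by move=> x; rewrite bimod_etens mul1r mulr1. Qed.
Fact bimod_scalerDr : right_distributive bimod_scale +%R.
Proof. by move=> u x y; have := bimod_scale_linr u 1 x y; rewrite !scale1r. Qed.
Fact bimod_scalerDl x : {morph bimod_scale^~ x : u v / u + v}.
Proof. by move=> u v; have := bimod_scale_linl x 1 u v; rewrite !scale1r. Qed.
HB.instance Definition _ := GRing.Zmodule_isLmodule.Build env bimod
  bimod_scalerA bimod_scale1r bimod_scalerDr bimod_scalerDl.

(* (a \otimes b) phi = fun x => phi (b x a) *)
Definition bimod_dual (X : lmodType env) : lmodType env := dual env_swap X.
End Enveloping.

(* Only the degrees n >= 1 are meaningful. *)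
Section TauHochschild.
Variables (k : fieldType) (A : falgType k).
Variable R : min_resolution (bimod A : lmodType (env A)).

Definition HHtau_upper (X : lmodType (env A)) (n : nat) : zmodType :=
  kdual (hom X (taun n R)).
Definition HHtau_lower (X : lmodType (env A)) (n : nat) : lmodType k :=
  hom (bimod_dual X) (taun n R).
End TauHochschild.

Record quiver := Quiver {
  vertex : finType; arrow : finType;
  asource : arrow -> vertex; atarget : arrow -> vertex }.

Section PathAlgebra.
Variables (k : fieldType) (Q : quiver).

Fixpoint composable (x : vertex Q) (s : seq (arrow Q)) : bool :=
  if s is a :: s' then (asource a == x) && composable (atarget a) s' else true.
Fixpoint endpoint (x : vertex Q) (s : seq (arrow Q)) : vertex Q :=
  if s is a :: s' then endpoint (atarget a) s' else x.

Lemma composable_cat x s t :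
  composable x (s ++ t) = composable x s && composable (endpoint x s) t.
Proof. by elim: s x => //= a s IHs x; rewrite IHs andbA. Qed.
Lemma endpoint_cat x s t : endpoint x (s ++ t) = endpoint (endpoint x s) t.
Proof. by elim: s x => /=. Qed.

(* A path is its source followed by its arrows, in the order in which they are
   traversed. *)
Definition qpath := {p : vertex Q * seq (arrow Q) | composable p.1 p.2}.
Definition psource (p : qpath) : vertex Q := (val p).1.
Definition parrows (p : qpath) : seq (arrow Q) := (val p).2.
Definition ptarget (p : qpath) : vertex Q := endpoint (psource p) (parrows p).

Definition ptriv (x : vertex Q) : qpath := exist _ (x, [::]) isT.
Fact parrow_subproof (a : arrow Q) : composable (asource a) [:: a].
Proof. by rewrite /= eqxx. Qed.
Definition parrow (a : arrow Q) : qpath :=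
  exist _ (asource a, [:: a]) (parrow_subproof a).
Fact pcat_subproof (q p : qpath) : psource q = ptarget p ->
  composable (psource p) (parrows p ++ parrows q).
Proof.
move=> qp; rewrite composable_cat; apply/andP; split; first exact: (valP p).
by move: (valP q); rewrite -[(val q).1]/(psource q) qp.
Qed.
Definition pcat (q p : qpath) (qp : psource q = ptarget p) : qpath :=
  exist _ (psource p, parrows p ++ parrows q) (pcat_subproof qp).

Definition pathalg : Type := {freeg qpath / k}.
HB.instance Definition _ := GRing.Lmodule.on pathalg.
Definition pbasis (p : qpath) : pathalg := << p >>.
Definition pcoef (p : qpath) (u : pathalg) : k := coeff p u.

(* Paths are composed from right to left: p first, then q. *)
Definition pmul (q p : qpath) : pathalg :=
  match psource q =P ptarget p with
  | ReflectT qp => pbasis (pcat qp)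
  | ReflectF _ => 0
  end.
Definition pathalg_mul (u v : pathalg) : pathalg :=
  fglift (fun q => fglift (pmul q) v : pathalg) u.
Definition pathalg_one : pathalg := \sum_(x : vertex Q) pbasis (ptriv x).

Lemma pathalg_ind (H : pathalg -> Prop) :
  H 0 -> (forall c p u, H u -> H (c *: pbasis p + u)) -> forall u, H u.
Proof.
move=> H0 HD u; rewrite -(freeg_sumE u); elim/big_rec: _ => // p v _ Hv.
suff -> : << coeff p u *g p >> = coeff p u *: pbasis p by exact: HD.
by apply/eqP/freeg_eqP => q; rewrite coeffZ !coeffU mul1r.
Qed.

Lemma pathalg_mul_linl v : linear (pathalg_mul^~ v).
Proof. by move=> c x y; apply: linearP. Qed.
Lemma pathalg_mul_linr u : linear (pathalg_mul u).
Proof.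
move=> c x y; rewrite /pathalg_mul !fglift_sum scaler_sumr -big_split.
apply: eq_bigr => q _ /=; rewrite linearP scalerDr !scalerA; congr (_ *: _ + _).
exact: mulrC.
Qed.
Lemma pathalg_mul_basis q p : pathalg_mul (pbasis q) (pbasis p) = pmul q p.
Proof. by rewrite /pathalg_mul !fglift1. Qed.
Lemma pathalg_mul0l v : pathalg_mul 0 v = 0.
Proof. by have := pathalg_mul_linl v (-1) 0 0; rewrite scaler0 addr0 scaleN1r addNr. Qed.
Lemma pathalg_mul0r v : pathalg_mul v 0 = 0.
Proof. by have := pathalg_mul_linr v (-1) 0 0; rewrite scaler0 addr0 scaleN1r addNr. Qed.

Lemma pmul_pcat q p (qp : psource q = ptarget p) : pmul q p = pbasis (pcat qp).
Proof. by rewrite /pmul; case: eqP => // e; rewrite (eq_irrelevance e qp). Qed.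
Lemma pmul_neq q p : psource q <> ptarget p -> pmul q p = 0.
Proof. by rewrite /pmul; case: eqP. Qed.
Lemma ptarget_pcat q p (qp : psource q = ptarget p) : ptarget (pcat qp) = ptarget q.
Proof. by rewrite /ptarget /= endpoint_cat -[endpoint _ (parrows p)]/(ptarget p) qp. Qed.

Fact pathalg_mulA : associative pathalg_mul.
Proof.
elim/pathalg_ind=> [v w|c r u IHu v w]; first by rewrite !pathalg_mul0l.
rewrite !pathalg_mul_linl IHu; congr (c *: _ + _).
elim/pathalg_ind: v w => [|{}c q v IHv] w; first by rewrite !(pathalg_mul0l, pathalg_mul0r).
rewrite pathalg_mul_linl !pathalg_mul_linr pathalg_mul_linl IHv; congr (c *: _ + _).
elim/pathalg_ind: w => [|{}c p w IHw]; first by rewrite !pathalg_mul0r.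
rewrite !pathalg_mul_linr IHw !pathalg_mul_basis; congr (c *: _ + _).
have [qp|nqp] := psource q =P ptarget p; have [rq|nrq] := psource r =P ptarget q.
- rewrite (pmul_pcat qp) (pmul_pcat rq) !pathalg_mul_basis.
  have r_qp : psource r = ptarget (pcat qp) by rewrite ptarget_pcat.
  have rq_p : psource (pcat rq) = ptarget p by [].
  rewrite (pmul_pcat r_qp) (pmul_pcat rq_p); congr pbasis; apply: val_inj.
  by rewrite /= /parrows /= catA.
- rewrite (pmul_pcat qp) (pmul_neq nrq) pathalg_mul0l pathalg_mul_basis pmul_neq //.
  by rewrite ptarget_pcat.
- rewrite (pmul_pcat rq) (pmul_neq nqp) pathalg_mul0r pathalg_mul_basis pmul_neq //.
- by rewrite !pmul_neq // pathalg_mul0l pathalg_mul0r.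
Qed.
Lemma pathalg_sumr u (I : finType) (F : I -> pathalg) :
  pathalg_mul u (\sum_i F i) = \sum_i pathalg_mul u (F i).
Proof.
elim/big_rec2: _ => [|i y1 y2 _ <-]; first exact: pathalg_mul0r.
by have := pathalg_mul_linr u 1 (F i) y2; rewrite !scale1r.
Qed.
Lemma pathalg_suml u (I : finType) (F : I -> pathalg) :
  pathalg_mul (\sum_i F i) u = \sum_i pathalg_mul (F i) u.
Proof.
elim/big_rec2: _ => [|i y1 y2 _ <-]; first exact: pathalg_mul0l.
by have := pathalg_mul_linl u 1 (F i) y2; rewrite !scale1r.
Qed.
Fact pathalg_mul1 : left_id pathalg_one pathalg_mul.
Proof.
elim/pathalg_ind=> [|c p u IHu]; first exact: pathalg_mul0r.
rewrite pathalg_mul_linr IHu; congr (c *: _ + _).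
rewrite pathalg_suml (bigD1 (ptarget p)) //= big1 => [|x /eqP nx].
  rewrite pathalg_mul_basis addr0 pmul_pcat; congr pbasis; apply: val_inj.
  by rewrite /= cats0; case: (p) => -[].
by rewrite pathalg_mul_basis pmul_neq.
Qed.
Fact pathalg_mulr1 : right_id pathalg_one pathalg_mul.
Proof.
elim/pathalg_ind=> [|c p u IHu]; first exact: pathalg_mul0l.
rewrite pathalg_mul_linl IHu; congr (c *: _ + _).
rewrite pathalg_sumr (bigD1 (psource p)) //= big1 => [|x /eqP nx].
  rewrite pathalg_mul_basis addr0 pmul_pcat; congr pbasis; apply: val_inj.
  by rewrite /=; case: (p) => -[].
by rewrite pathalg_mul_basis pmul_neq // => /esym.
Qed.
Fact pathalg_mulDl : left_distributive pathalg_mul +%R.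
Proof. by move=> x y v; have := pathalg_mul_linl v 1 x y; rewrite !scale1r. Qed.
Fact pathalg_mulDr : right_distributive pathalg_mul +%R.
Proof. by move=> u x y; have := pathalg_mul_linr u 1 x y; rewrite !scale1r. Qed.
HB.instance Definition _ := GRing.Zmodule_isPzRing.Build pathalg
  pathalg_mulA pathalg_mul1 pathalg_mulr1 pathalg_mulDl pathalg_mulDr.

Definition ideal (I : pathalg -> Prop) :=
  [/\ I 0, forall u v, I u -> I v -> I (u + v)
    & forall a u b, I u -> I (a * u * b)].
Definition arrow_ideal (u : pathalg) :=
  forall I, ideal I -> (forall a, I (pbasis (parrow a))) -> I u.
Definition ideal_mul (I J : pathalg -> Prop) (u : pathalg) :=
  exists n (a b : 'I_n -> pathalg),
    [/\ forall i, I (a i), forall i, J (b i) & u = \sum_i a i * b i].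
Fixpoint ideal_pow (I : pathalg -> Prop) (m : nat) : pathalg -> Prop :=
  if m is m'.+1 then ideal_mul I (ideal_pow I m') else fun _ => True.

Definition admissible (I : pathalg -> Prop) :=
  [/\ ideal I,
      exists2 m, (2 <= m)%N & forall u, ideal_pow arrow_ideal m u -> I u
    & forall u, I u -> ideal_pow arrow_ideal 2 u].

Lemma pcoef_triv_mul x u v :
  pcoef (ptriv x) (u * v) = pcoef (ptriv x) u * pcoef (ptriv x) v.
Proof.
have triv_nil q : parrows q = [::] -> q = ptriv (psource q).
  by move=> q0; apply: val_inj; rewrite /= -q0; case: (q) => -[].
have E q p : pcoef (ptriv x) (pmul q p) = (q == ptriv x)%:R * (p == ptriv x)%:R.
  have [qp|nqp] := psource q =P ptarget p; last first.
    rewrite pmul_neq // /pcoef coeff0.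
    have [qx|] := eqVneq q; last by rewrite mul0r.
    have [px|] := eqVneq p; last by rewrite mulr0.
    by case: nqp; rewrite qx px.
  rewrite (pmul_pcat qp) /pcoef coeffU mul1r -natrM mulnb; congr ((nat_of_bool _)%:R).
  apply/eqP/andP => [/(congr1 val)[px]|[/eqP qx /eqP px]]; last first.
    by apply: val_inj; rewrite /= px qx.
  case Ep: (parrows p) => //= /triv_nil Eq; have Epx := triv_nil _ Ep.
  have qx : psource q = x by rewrite qp Epx -px.
  by rewrite Eq Epx qx px.
elim/pathalg_ind: u => [|c q u IHu].
  by rewrite mul0r /pcoef coeff0 mul0r.
rewrite [_ * _]pathalg_mul_linl /pcoef !coeffD !coeffZ mulrDl -!/(pcoef _ _).
rewrite -[pathalg_mul u v]/(u * v) IHu -mulrA; congr (c * _ + _).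
elim/pathalg_ind: v {IHu} => [|{}c p v IHv].
  by rewrite pathalg_mul0r /pcoef coeff0 mulr0.
rewrite pathalg_mul_linr /pcoef !coeffD !coeffZ mulrDr -!/(pcoef _ _) IHv.
congr (_ + _); rewrite pathalg_mul_basis E [RHS]mulrCA; congr (c * _).
by rewrite /pcoef !coeffU !mul1r.
Qed.

Lemma arrow_ideal_triv x u : arrow_ideal u -> pcoef (ptriv x) u = 0.
Proof.
move/(_ (fun v => pcoef (ptriv x) v = 0)); apply=> [|a]; last first.
  by rewrite /pcoef coeffU mul1r; case: eqP => // /(congr1 val).
split=> [|u1 u2 c1 c2|a u1 b c1]; first exact: coeff0.
  by rewrite /pcoef coeffD -!/(pcoef _ _) c1 c2 addr0.
by rewrite !pcoef_triv_mul c1 mulr0 mul0r.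
Qed.

Lemma admissible_triv I x u : admissible I -> I u -> pcoef (ptriv x) u = 0.
Proof.
move=> [_ _ IF] /IF[n [a [b [Fa _ ->]]]]; rewrite /pcoef raddf_sum big1 // => i _.
by apply: etrans (pcoef_triv_mul x (a i) (b i)) _; rewrite arrow_ideal_triv ?mul0r.
Qed.
End PathAlgebra.

(* [bq_alg] is k Q / I, given by a surjective algebra map from k Q with kernel I.
   As a [falgType] is nonzero, the quiver is nonempty. *)
Record bound_quiver_algebra (k : fieldType) := BoundQuiverAlgebra {
  bq_quiver : quiver;
  bq_rel : pathalg k bq_quiver -> Prop;
  bq_admissible : admissible bq_rel;
  bq_alg :> falgType k;
  bq_pi : {rmorphism pathalg k bq_quiver -> bq_alg};
  bq_pi_scalable : scalable bq_pi;
  bq_pi_surj : forall a, exists u, bq_pi u = a;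
  bq_pi_ker : forall u, bq_pi u = 0 <-> bq_rel u
}.

Section BoundQuiverAlgebra.
Variables (k : fieldType) (L : bound_quiver_algebra k).
Local Notation Q := (bq_quiver L).

Definition bq_vertex : finType := vertex Q.
Definition bq_idem (x : bq_vertex) : L := bq_pi L (pbasis k (ptriv x)).

Definition lsimple (x : bq_vertex) : Type := k.
Definition rsimple (x : bq_vertex) : Type := k.

Section Simple.
Variable x : bq_vertex.

(* The coefficient of e_x in any preimage of [a] in k Q (lemma [bq_char_pi]);
   it gives the action of [a] on the simple modules at x. *)
Definition bq_char (a : L) : k := pcoef (ptriv x) (projT1 (cid (bq_pi_surj a))).

Lemma bq_char_pi u : bq_char (bq_pi L u) = pcoef (ptriv x) u.
Proof.
rewrite /bq_char; case: cid => v /= vu.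
suff: pcoef (ptriv x) (v - u) = 0 by move/eqP; rewrite /pcoef coeffB subr_eq0 => /eqP.
apply: (admissible_triv _ (bq_admissible L)); apply/bq_pi_ker.
by rewrite rmorphB vu subrr.
Qed.
Lemma bq_charD a b : bq_char (a + b) = bq_char a + bq_char b.
Proof.
have [[u <-] [v <-]] := (bq_pi_surj a, bq_pi_surj b).
by rewrite -rmorphD !bq_char_pi; apply: coeffD.
Qed.
Lemma bq_charM a b : bq_char (a * b) = bq_char a * bq_char b.
Proof.
have [[u <-] [v <-]] := (bq_pi_surj a, bq_pi_surj b).
by rewrite -rmorphM !bq_char_pi pcoef_triv_mul.
Qed.
Lemma bq_char1 : bq_char 1 = 1.
Proof.
rewrite -(rmorph1 (bq_pi L)) bq_char_pi [pcoef _ _]raddf_sum (bigD1 x) //= big1 => [|y yx].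
  by rewrite addr0 coeffU eqxx mulr1.
rewrite coeffU mul1r; case: eqP => // /(congr1 val)[yx'].
by rewrite yx' eqxx in yx.
Qed.

HB.instance Definition _ := GRing.Zmodule.on (lsimple x).
Definition lsimple_scale (a : L) (c : lsimple x) : lsimple x := bq_char a * (c : k).
Fact lsimple_scalerA a b c :
  lsimple_scale a (lsimple_scale b c) = lsimple_scale (a * b) c.
Proof. by rewrite /lsimple_scale bq_charM mulrA. Qed.
Fact lsimple_scale1r : left_id 1 lsimple_scale.
Proof. by move=> c; rewrite /lsimple_scale bq_char1 mul1r. Qed.
Fact lsimple_scalerDr : right_distributive lsimple_scale +%R.
Proof. by move=> a c d; apply: mulrDr. Qed.
Fact lsimple_scalerDl c : {morph lsimple_scale^~ c : a b / a + b}.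
Proof. by move=> a b; rewrite /lsimple_scale bq_charD mulrDl. Qed.
HB.instance Definition _ := GRing.Zmodule_isLmodule.Build L (lsimple x)
  lsimple_scalerA lsimple_scale1r lsimple_scalerDr lsimple_scalerDl.

HB.instance Definition _ := GRing.Zmodule.on (rsimple x).
Definition rsimple_scale (a : L^c) (c : rsimple x) : rsimple x :=
  bq_char (a : L) * (c : k).
Fact rsimple_scalerA a b c :
  rsimple_scale a (rsimple_scale b c) = rsimple_scale (a * b) c.
Proof. by rewrite /rsimple_scale bq_charM mulrA [bq_char b * _]mulrC. Qed.
Fact rsimple_scale1r : left_id 1 rsimple_scale.
Proof. by move=> c; rewrite /rsimple_scale bq_char1 mul1r. Qed.
Fact rsimple_scalerDr : right_distributive rsimple_scale +%R.
Proof. by move=> a c d; apply: mulrDr. Qed.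
Fact rsimple_scalerDl c : {morph rsimple_scale^~ c : a b / a + b}.
Proof. by move=> a b; rewrite /rsimple_scale bq_charD mulrDl. Qed.
HB.instance Definition _ := GRing.Zmodule_isLmodule.Build L^c (rsimple x)
  rsimple_scalerA rsimple_scale1r rsimple_scalerDr rsimple_scalerDl.
End Simple.

Definition Tor_infinite (X : lmodType L^c) (M : lmodType L) :=
  forall P : proj_resolution M, infinite_graded (Tor X P).

Definition inf_plus_gldim :=
  exists x y : bq_vertex,
    (exists a : L, bq_idem y * a * bq_idem x != 0) /\
    Tor_infinite (rsimple x) (lsimple y).
Definition inf_coplus_gldim :=
  exists x y : bq_vertex,
    (exists a : L, bq_idem y * a * bq_idem x != 0) /\
    Tor_infinite (rsimple y) (lsimple x).
End BoundQuiverAlgebra.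

(* The data of a k-category with finitely many objects. *)
Record kcat_data (k : fieldType) := KCatData {
  kobj : finType;
  kmor : kobj -> kobj -> lmodType k;
  kid : forall x, kmor x x;
  kcomp : forall x y z, kmor y z -> kmor x y -> kmor x z
}.

Section Subcategory.
Variables (k : fieldType) (C : kcat_data k).

Record subcategory := Subcategory {
  sub_obj : {set kobj C};
  sub_mor : forall x y : kobj C, submodClosed (kmor x y);
  sub_id : forall x, x \in sub_obj -> kid x \in sub_mor x x;
  sub_comp : forall x y z (g : kmor y z) (f : kmor x y),
    x \in sub_obj -> y \in sub_obj -> z \in sub_obj ->
    g \in sub_mor y z -> f \in sub_mor x y -> kcomp g f \in sub_mor x z
}.
Variable E : subcategory.

(* There are finitely many objects, so the sum of the dimensions is infinite if
   and only if one of them is. *)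
Definition inf_dim :=
  exists x y, [/\ x \in sub_obj E, y \in sub_obj E & ~ fin_dim (subm (sub_mor E x y))].

Inductive generated n (s t : 'I_n -> kobj C) (g : forall i, kmor (s i) (t i)) :
    forall x y, kmor x y -> Prop :=
| GenIn i : generated g (g i)
| GenId x : x \in sub_obj E -> generated g (kid x)
| GenComp x y z (a : kmor y z) (b : kmor x y) :
    generated g a -> generated g b -> generated g (kcomp a b)
| GenZero x y :
    x \in sub_obj E -> y \in sub_obj E -> generated g (0 : kmor x y)
| GenLin x y c (a b : kmor x y) :
    generated g a -> generated g b -> generated g (c *: a + b).

Definition fin_gen :=
  exists n (s t : 'I_n -> kobj C) (g : forall i, kmor (s i) (t i)),
    (forall i, [/\ s i \in sub_obj E, t i \in sub_obj E & g i \in sub_mor E (s i) (t i)]) /\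
    (forall x y (f : kmor x y), x \in sub_obj E -> y \in sub_obj E ->
       f \in sub_mor E x y -> generated g f).
End Subcategory.

Definition yoneda_category (k : fieldType) (L : bound_quiver_algebra k)
    (P : forall x : bq_vertex L, proj_resolution (lsimple x : lmodType L)) :
  kcat_data k :=
  @KCatData k (bq_vertex L) (Exts P) (yoneda_id P) (@yoneda_comp _ _ _ _ P).

(* Main.v *)
From HB Require Import structures.
From mathcomp Require Import all_boot all_algebra all_field.
From mathcomp Require Import boolp functions freeg.
Require Import Defs.

Set Implicit Arguments.
Unset Strict Implicit.
Unset Printing Implicit Defensive.

Import GRing.Theory.
Local Open Scope ring_scope.

(** Everything comes from a single vertex [x] with [Ext^n(S_x, S_x)] nonzero for
    infinitely many [n].  Such a vertex exists: if all the spaces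
    [Ext^*(S_x, S_x)] lived in degrees below some [N], then a product of
    generators of [E] could be grouped, by cutting at the passages through each
    vertex in turn, into at most one loop per vertex and the generators between
    these loops.  Degrees add up in a product, so the products of generators
    would live in bounded degrees, and a subspace of [Ext^*] in bounded degrees
    is finite dimensional ([word_cut], [word_bounded],
    [fin_gen_infinite_loop]).  Grouping needs the Yoneda product to be an
    associative bilinear operation, which follows from its independence of the
    chosen cocycles and lifts ([yoneda_represents]).

    The pair [(x, x)] witnesses both homological conditions: [e_x] is nonzero,
    and [Tor_n(k_x, S_x)] is dual to [Ext^n(S_x, S_x)] ([Ext_Tor]), the latter
    being the same for all resolutions ([Ext_independent]).

    For the last conclusion let [R] be the resolution of [L] by bimodules and
    [X] a bimodule.  A bimodule map from [X] to the translate of a syzygy is a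
    linear form on the cokernel of [Hom(R_n, X) -> Hom(R_(n+1), X)], so such a
    nonzero map exists whenever this restriction map is not onto
    ([hom_to_tau]).  Two consecutive restriction maps compose to zero, hence
    cannot both be onto unless [Hom(R_(n+2), X) = 0] ([hom_taun_consecutive]).
    It remains to see that [Hom(R_n, X)] is nonzero for infinitely many [n],
    when [X] is [L] or its dual.  Both receive nonzero
    maps from [R_n] as soon as the simple bimodule at [(x, x)] does: it is a
    quotient of [L], along which maps from the projective [R_n] lift, and it
    embeds in the dual of [L].  Finally [R (x)_L S_x] is a projective
    resolution of [S_x], because [R] splits as a complex of right modules, and
    the maps from its [n]-th term to [S_x] are the maps from [R_n] to that
    simple bimodule ([simple_resolution]); so these are nonzero whenever
    [Ext^n(S_x, S_x)] is. *)

Definition linearOf (R : pzRingType) (U V : lmodType R) (f : U -> V)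
    (lf : linear f) : {linear U -> V} :=
  HB.pack f (GRing.isLinear.Build R U V _ f lf).

(** * Finite-dimensional spaces without a chosen basis *)

Section FinDim.
Variable k : fieldType.

Definition comb (V : lmodType k) n (b : 'I_n -> V) (r : 'rV[k]_n) : V :=
  \sum_i r 0 i *: b i.
Fact comb_linear (V : lmodType k) n (b : 'I_n -> V) : linear (comb b).
Proof.
move=> a r s; rewrite /comb scaler_sumr -big_split; apply: eq_bigr => i _ /=.
by rewrite !mxE scalerDl scalerA.
Qed.
HB.instance Definition _ (V : lmodType k) n (b : 'I_n -> V) :=
  GRing.isLinear.Build k 'rV[k]_n V _ (comb b) (comb_linear b).

Lemma comb_onto (V : lmodType k) n (b : 'I_n -> V) :
  (forall v, exists c : 'I_n -> k, v = \sum_i c i *: b i) ->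
  forall v, exists r, comb b r = v.
Proof.
move=> bV v; have [c ->] := bV v; exists (\row_i c i).
by apply: eq_bigr => i _; rewrite mxE.
Qed.

Lemma fin_dim_fintype (V : lmodType k) (J : finType) (b : J -> V) :
  (forall v, exists c : J -> k, v = \sum_j c j *: b j) -> fin_dim V.
Proof.
move=> bV; exists #|J|, (fun i => b (enum_val i)) => v; have [c ->] := bV v.
by exists (fun i => c (enum_val i)); rewrite [LHS](reindex _ (onW_bij _ (enum_val_bij J))).
Qed.

Lemma fin_dim_onto (V W : lmodType k) (f : {linear V -> W}) :
  (forall w, exists v, f v = w) -> fin_dim V -> fin_dim W.
Proof.
move=> fW [n [b bV]]; exists n, (fun i => f (b i)) => w.
have [v <-] := fW w; have [c ->] := bV v; exists c.
by rewrite linear_sum; apply: eq_bigr => i _; rewrite linearZ.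
Qed.

Lemma fin_dim_ffun (V : lmodType k) m : fin_dim V -> fin_dim {ffun 'I_m -> V}.
Proof.
move=> [n [b bV]].
pose e (ij : 'I_m * 'I_n) : {ffun 'I_m -> V} := [ffun i => if i == ij.1 then b ij.2 else 0].
apply: (@fin_dim_fintype _ _ e) => f.
have /choice[c cP] i : exists c : 'I_n -> k, f i = \sum_j c j *: b j by apply: bV.
exists (fun ij => c ij.1 ij.2); apply/ffunP => i.
rewrite cP sum_ffunE -(pair_bigA _ (fun i j => (c i j *: e (i, j)) _)) /=.
rewrite (bigD1 i) //= [X in _ + X]big1 ?addr0 => [|i' ni].
  by apply: eq_bigr => j _; rewrite !ffunE eqxx.
by apply: big1 => j _; rewrite !ffunE eq_sym (negPf ni) scaler0.
Qed.

Lemma fin_dim_pair (V W : lmodType k) : fin_dim V -> fin_dim W -> fin_dim (V * W)%type.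
Proof.
move=> [m [b bV]] [n [d dW]].
pose e (ij : 'I_m + 'I_n) : (V * W)%type :=
  match ij with inl i => (b i, 0) | inr j => (0, d j) end.
apply: (@fin_dim_fintype _ _ e) => -[v w].
have [[c ->] [c' ->]] := (bV v, dW w).
exists (fun ij => match ij with inl i => c i | inr j => c' j end).
rewrite big_sumType /=.
have -> : \sum_i c i *: (b i, 0 : W) = (\sum_i c i *: b i, 0).
  elim/big_rec2: _ => // i y _ _ ->.
  by congr pair; rewrite /= ?scaler0 ?addr0.
have -> : \sum_i c' i *: (0 : V, d i) = (0, \sum_i c' i *: d i).
  elim/big_rec2: _ => // i y _ _ ->.
  by congr pair; rewrite /= ?scaler0 ?addr0.
by congr pair; rewrite /= ?addr0 ?add0r.
Qed.

(** A matrix of largest rank among those with rows in [N] has all of [N] as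
    its row space: otherwise adding a row of [N] would increase the rank. *)
Lemma submod_rowspace n (N : submodClosed 'rV[k]_n) :
  exists A : 'M[k]_n, forall r, (r \in N) = (r <= A)%MS.
Proof.
pose good r := `[< exists A : 'M[k]_n,
  \rank A = r /\ forall v : 'rV_n, (v <= A)%MS -> v \in N >].
have good0 : exists r, good r.
  exists 0%N; apply/asboolP; exists 0; split=> [|v]; first exact: mxrank0.
  by rewrite submx0 => /eqP->; apply: rpred0.
have goodB r : good r -> (r <= n)%N.
  by move=> /asboolP[A [<- _]]; apply: rank_leq_row.
have [m /asboolP[A [rA AN]] max_m] := ex_maxnP good0 goodB.
exists A => r; apply/idP/idP => [rN|/AN //]; apply: contraT => nrA.
(* all rows of A + r are in N, although its rank exceeds the maximum m *)
have : (\rank (A + r)%MS <= m)%N.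
  apply: max_m; apply/asboolP; exists (A + r)%MS; split=> // v /sub_addsmxP[[u w]] /= ->.
  by apply: rpredD; [apply: AN; apply: submxMl | rewrite [w]mx11_scalar mul_scalar_mx rpredZ].
rewrite leqNgt -rA => /negP[]; apply: rank_ltmx.
rewrite ltmxE addsmxSl /=; apply: contra nrA; exact: submx_trans (addsmxSr _ _).
Qed.

Lemma fin_dim_subm (V : lmodType k) (N : submodClosed V) :
  fin_dim V -> fin_dim (subm N).
Proof.
move=> [n [b bV]].
have [A AN] := submod_rowspace (preimp (comb b) N : submodClosed _).
have rowN i : comb b (row i A) \in N.
  have : row i A \in preimp (comb b) N by rewrite AN row_sub.
  by [].
exists n, (fun i => Subm (rowN i)) => -[v vN].
have [r rv] := comb_onto bV v.
have : r \in preimp (comb b) N by rewrite unfold_in /= /preimp rv.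
rewrite AN => /submxP[c rE]; exists (fun i => c 0 i); apply: val_inj.
rewrite [in RHS]raddf_sum /= -rv rE mulmx_sum_row linear_sum.
by apply: eq_bigr => i _; rewrite linearZ.
Qed.

Lemma fin_dim_inj (V W : lmodType k) (f : {linear V -> W}) :
  injective f -> fin_dim W -> fin_dim V.
Proof.
move=> f_inj /(@fin_dim_subm _ (imp f)) fdim.
have pre (w : subm (imp f)) : exists v, f v = val w by apply/asboolP; apply: (valP w).
pose g w := projT1 (cid (pre w)).
have gK w : f (g w) = val w by apply: projT2 (cid (pre w)).
have g_lin : linear g by move=> a u v; apply: f_inj; rewrite linearP !gK.
pose gL : {linear subm (imp f) -> V} := linearOf g_lin.
apply: (fin_dim_onto (f := gL)) fdim => v.
have fv : f v \in imp f by apply/asboolP; exists v.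
by exists (Subm fv); apply: f_inj; rewrite gK.
Qed.

(** Rank-nullity in the form used for filtrations: a subspace is finite
    dimensional as soon as it is so on the kernel and on the image of a map. *)
Lemma fin_dim_ext (V W : lmodType k) (N K : submodClosed V) (f : {linear V -> W}) :
  fin_dim W -> (forall v, v \in N -> f v = 0 -> v \in K) ->
  fin_dim (subm K) -> fin_dim (subm N).
Proof.
move=> fW KN fK.
pose fN (v : subm N) : W := f (val v).
have fN_lin : linear fN by move=> a u v; rewrite /fN !linearP.
pose fL : {linear subm N -> W} := linearOf fN_lin.
have [m [e eI]] := fin_dim_subm (imp fL) fW.
have /choice[v vE] i : exists v, fL v = val (e i) by apply/asboolP; apply: (valP (e i)).
have kerK (z : kerm fL) : val (val z) \in K.
  by apply: KN; [apply: valP | apply/eqP; apply: (valP z)].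
pose h (z : kerm fL) : subm K := Subm (kerK z).
have h_lin : linear h by move=> a z w; apply: val_inj; rewrite [LHS]/(val (val _)) !linearP.
pose hL : {linear kerm fL -> subm K} := linearOf h_lin.
have [|n [d dK]] := fin_dim_inj (f := hL) _ fK.
  by move=> z w /(congr1 val) /= zw; apply/val_inj/val_inj.
pose g (ij : 'I_m + 'I_n) : subm N := match ij with inl i => v i | inr j => val (d j) end.
apply: (@fin_dim_fintype _ _ g) => u.
have uI : fL u \in imp fL by apply/asboolP; exists u.
have [c cE] := eI (Subm uI).
have cU : fL u = fL (\sum_i c i *: v i).
  rewrite (linear_sum fL) -[LHS]/(val (Subm uI)) cE raddf_sum; apply: eq_bigr => i _.
  by rewrite [RHS]linearZ vE [LHS]linearZ.
have kU : u - \sum_i c i *: v i \in kerp fL.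
  by apply/eqP; rewrite linearB cU subrr.
have [c' cE'] := dK (Subm kU).
exists (fun ij => match ij with inl i => c i | inr j => c' j end).
rewrite big_sumType /=; apply/eqP; rewrite addrC -subr_eq; apply/eqP.
rewrite -[LHS]/(val (Subm kU)) cE' raddf_sum; apply: eq_bigr => j _.
by rewrite [LHS]linearZ.
Qed.

(** In coordinates [N] is the row space of a matrix, whose cokernel matrix
    consists of the linear forms that vanish on [N]. *)
Lemma separating_form (V : lmodType k) (N : submodClosed V) v :
  fin_dim V -> v \notin N ->
  exists2 f : {linear V -> k^o}, (forall u, u \in N -> f u = 0) & f v != 0.
Proof.
move=> [n [b bV]] vN.
have [A AN] := submod_rowspace (preimp (comb b) N : submodClosed _).
have rA r : (comb b r \in N) = (r <= A)%MS by rewrite -AN.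
have [c cE] := choice (comb_onto bV).
have : (c v <= A)%MS = false by rewrite -rA cE (negPf vN).
rewrite submxE => /negbT nz.
have [j nzj] : exists j, (c v *m cokermx A) 0 j != 0.
  apply/existsP; apply: contraNT nz => /existsPn z.
  by apply/eqP/rowP => j; rewrite [RHS]mxE; apply/eqP; have := z j; rewrite negbK.
pose phi (r : 'rV[k]_n) : k^o := (r *m cokermx A) 0 j.
have phi_lin : linear phi.
  have E a (X Y : 'rV[k]_n) : (a *: X + Y) 0 j = a * X 0 j + Y 0 j by rewrite !mxE.
  by move=> a r s; rewrite /phi mulmxDl -scalemxAl; apply: E.
pose Phi : {linear 'rV[k]_n -> k^o} := linearOf phi_lin.
have kill r : comb b r \in N -> Phi r = 0.
  by rewrite rA submxE /= /phi => /eqP->; rewrite mxE.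
pose f u := Phi (c u).
have f_lin : linear f.
  move=> a u w; apply/eqP; rewrite -subr_eq0 -linearP -linearB; apply/eqP/kill.
  by rewrite (linearB (comb b)) /= (linearP (comb b)) /= !cE subrr rpred0.
exists (linearOf f_lin) => //= u uN.
by apply: kill; rewrite cE.
Qed.

(** The graph of the sought form is a subspace of [V * k] which does not
    contain (0, 1); a form on [V * k] separating the two solves for it. *)
Lemma factor_form (U V : lmodType k) (f : {linear U -> V}) (g : {linear U -> k^o}) :
  fin_dim V -> (forall u, f u = 0 -> g u = 0) ->
  exists h : {linear V -> k^o}, forall u, g u = h (f u).
Proof.
move=> fV fg.
pose t u : (V * k^o)%type := (f u, g u).
have t_lin : linear t by move=> a u w; rewrite /t !linearP.
pose tL : {linear U -> (V * k^o)%type} := linearOf t_lin.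
have fk : fin_dim k^o.
  by exists 1%N, (fun=> 1) => a; exists (fun=> a); rewrite big_ord1 [RHS]mulr1.
have n01 : ((0, 1) : (V * k^o)%type) \notin imp tL.
  apply/asboolP => -[u [/fg gu0 gu1]]; move: gu1; rewrite gu0 => /eqP.
  by rewrite eq_sym oner_eq0.
have [s s0 s1] := separating_form (fin_dim_pair fV fk) n01.
set e := s _ in s1.
pose h v : k^o := - (s (v, 0) / e).
have h_lin : linear h.
  move=> a v w; rewrite /h.
  have -> : ((a *: v + w, 0) : (V * k^o)%type) = a *: (v, 0) + (w, 0).
    by congr pair; rewrite /= scaler0 addr0.
  by rewrite linearP mulrDl opprD scalerN -scalerAl.
exists (linearOf h_lin) => u /=.
have : s (f u, g u) = 0 by apply: s0; apply/asboolP; exists u.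
have -> : ((f u, g u) : (V * k^o)%type) = g u *: (0, 1) + (f u, 0).
  by congr pair; rewrite /= ?scaler0 ?add0r ?addr0 // [RHS]mulr1.
rewrite linearP -/e => /eqP; rewrite addr_eq0 => /eqP E.
by rewrite /h -mulNr -E [X in X / e]/(g u * e) mulfK.
Qed.
End FinDim.

(** * Comparison of complexes *)

Section NullHomotopy.
Variables (k : fieldType) (A : algType k).
Variables (X Y : nat -> lmodType A).
Variables (dX : forall n, {linear X n.+1 -> X n}).
Variables (dY : forall n, {linear Y n.+1 -> Y n}).
Hypothesis projX : forall n, projective (X n).
Hypothesis dX2 : forall n p, dX n (dX n.+1 p) = 0.
Hypothesis exactY : forall n q, dY n q = 0 -> exists r, dY n.+1 r = q.

(** Chain maps that agree on homology in degree 0 are homotopic; the second one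
    is [e] in degree 0 and zero elsewhere.  The homotopy is built degree by degree: [f n.+1 - s n \o dX n] takes values
    in the cycles of [Y], hence lifts through [dY n.+1].  Stated for sequences
    with differentials rather than resolutions, so that it covers shifted
    complexes and complexes of restricted modules. *)
Lemma null_homotopy (f : forall n, {linear X n -> Y n}) (e : {linear X 0 -> Y 0}) :
  (forall n p, dY n (f n.+1 p) = f n (dX n p)) ->
  (forall p, e (dX 0 p) = 0) ->
  (forall p, exists q, dY 0 q = f 0 p - e p) ->
  exists s : forall n, {linear X n -> Y n.+1},
    (forall p, f 0 p = e p + dY 0 (s 0 p)) /\
    (forall n p, f n.+1 p = s n (dX n p) + dY n.+1 (s n.+1 p)).
Proof.
move=> chain edX f0e.
pose good n (s : {linear X n -> Y n.+1}) := forall p, dY n (s (dX n p)) = f n (dX n p).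
have s0P : exists s : {linear X 0 -> Y 1}, forall p, dY 0 (s p) = f 0 p - e p.
  have lin : linear (fun p => f 0 p - e p).
    by move=> a p q; rewrite !linearP scalerDr addrACA.
  exact: (lift_through_image (h := linearOf lin) (@projX 0)).
have [s0 s0E] := cid s0P.
have step n (s : {linear X n -> Y n.+1}) : good n s ->
    {t : {linear X n.+1 -> Y n.+2} | forall p, dY n.+1 (t p) = f n.+1 p - s (dX n p)}.
  move=> gs; apply: cid.
  have lin : linear (fun p => f n.+1 p - s (dX n p)).
    by move=> a p q; rewrite !linearP scalerDr addrACA.
  apply: (lift_through_image (h := linearOf lin) (@projX n.+1)) => p /=.
  by apply: exactY; rewrite linearB chain gs subrr.
have good0 : good 0 s0 by move=> p; rewrite s0E edX subr0.
have goodS n s gs : good n.+1 (sval (@step n s gs)).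
  by move=> p; rewrite (svalP (step n s gs)) dX2 linear0 subr0.
pose st := nat_rect (fun n => {s | good n s}) (exist _ s0 good0)
  (fun n s => exist _ _ (goodS n (sval s) (svalP s))).
exists (fun n => sval (st n)); split=> [p|n p]; first by rewrite /= s0E addrC subrK.
by rewrite /= (svalP (step _ _ _)) addrC subrK.
Qed.
End NullHomotopy.

(** * Representatives of extension classes *)

Section ExtClasses.
Variables (k : fieldType) (A : algType k) (M N : lmodType A).
Variable P : proj_resolution M.

Definition coboundary n (c : hom (P n) N) := c \in imp (codiff_in P N n).

(** Classes are handled through this relation because the Yoneda product is
    defined with chosen cocycles, while every cocycle gives the same class. *)
Definition represents n (c : hom (P n) N) (e : Ext P N n) :=
  exists2 z : cocycle N P n, val z = c & clsm _ z = e.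

Lemma represents_exists n (e : Ext P N n) : exists c, represents c e.
Proof. by exists (val (repm e)), (repm e); rewrite ?repmK. Qed.

Lemma represents_cocycle n (z : cocycle N P n) : represents (val z) (clsm _ z).
Proof. by exists z. Qed.

Lemma represents0 n : represents 0 (0 : Ext P N n).
Proof. by exists 0; rewrite raddf0. Qed.

Lemma represents_linear n a c c' (e e' : Ext P N n) :
  represents c e -> represents c' e' -> represents (a *: c + c') (a *: e + e').
Proof. by move=> [z <- <-] [w <- <-]; exists (a *: z + w); rewrite linearP. Qed.

Lemma represents_cobound n c c' (e e' : Ext P N n) :
  represents c e -> represents c' e' -> (e = e' <-> coboundary (c - c')).
Proof.
move=> [z <- <-] [w <- <-]; rewrite -raddfB.
by split=> [/clsm_eqP|zw]; [|apply/clsm_eqP].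
Qed.

Lemma represents_inj n c (e e' : Ext P N n) :
  represents c e -> represents c e' -> e = e'.
Proof. by move=> ce ce'; apply/(represents_cobound ce ce'); rewrite subrr; apply: rpred0. Qed.

Lemma represents_diff n c (e : Ext P N n) p : represents c e -> c (diff P n p) = 0.
Proof. by case=> z <- _; apply: cocycleP. Qed.

Lemma cocycle_represents n (c : hom (P n) N) :
  (forall p, c (diff P n p) = 0) -> exists e, represents c e.
Proof.
move=> c0; have cK : c \in kerp (codiff P N n) by apply/eqP/homE => p; apply: c0.
by exists (clsm _ (Subm cK : cocycle N P n)), (Subm cK).
Qed.

Lemma coboundaryS n (c : hom (P n.+1) N) :
  coboundary c <-> exists t : hom (P n) N, forall p, c p = t (diff P n p).
Proof.
split=> [/asboolP[t <-]|[t ct]]; first by exists t.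
by apply/asboolP; exists t; apply: homE => p; rewrite ct.
Qed.

Lemma coboundary0 (c : hom (P 0) N) : coboundary c <-> c = 0.
Proof.
split=> [/asboolP[t <-]//|->]; exact: rpred0.
Qed.
End ExtClasses.

Section ExtFinDim.
Variables (k : fieldType) (A : algType k).

(** A morphism is determined by its values on a finite spanning family. *)
Lemma hom_fin_dim (M N : lmodType A) :
  fin_dim (kspace M) -> fin_dim (kspace N) -> fin_dim (hom M N).
Proof.
move=> [m [b bM]] fN.
pose ev (f : hom M N) : {ffun 'I_m -> kspace N} := [ffun i => f (b i)].
have ev_lin : linear ev by move=> a f g; apply/ffunP => i; rewrite !ffunE.
apply: (fin_dim_inj (f := linearOf ev_lin)) (fin_dim_ffun m fN) => f g /ffunP /= fg.
apply: homE => x; have [c ->] := bM x; rewrite !linear_sum; apply: eq_bigr => i _.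
have := fg i; rewrite !ffunE => E.
by rewrite [c i *: b i]/(_ *: (b i : M)) !linearZ /= E.
Qed.

Lemma Ext_fin_dim (M N : lmodType A) (P : proj_resolution M) n :
  fin_dim (kspace N) -> fin_dim (Ext P N n).
Proof.
move=> fN; apply: (fin_dim_onto (f := clsm (bndp (codiff_in P N n) (g := codiff P N n)))).
  by move=> e; exists (repm e); apply: repmK.
exact/fin_dim_subm/hom_fin_dim/fN/res_fin.
Qed.
End ExtFinDim.

(** * The comparison theorem and the Yoneda product *)

Lemma homB_E (k : fieldType) (A : algType k) (M N : lmodType A) (f g : hom M N) x :
  hom_fun (f - g) x = f x - g x.
Proof. by []. Qed.

Lemma homZ_E (k : fieldType) (A : algType k) (M N : lmodType A) a (f : hom M N) x :
  hom_fun (a *: f) x = a%:A *: f x.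
Proof. by []. Qed.

Definition hcomp (k : fieldType) (A : algType k) (M N K : lmodType A)
  (g : hom N K) (f : hom M N) : hom M K := mkhom (g \o f).

Lemma hcompE (k : fieldType) (A : algType k) (M N K : lmodType A)
  (g : hom N K) (f : hom M N) x : hcomp g f x = g (f x).
Proof. by []. Qed.

Section Comparison.
Variables (k : fieldType) (A : algType k) (S T N : lmodType A).
Variables (P : proj_resolution S) (Q : proj_resolution T).

Lemma diff2 n p : diff P n (diff P n.+1 p) = 0.
Proof. by apply/diff_exact; exists p. Qed.
Lemma augm_diff p : augm P (diff P 0 p) = 0.
Proof. by apply/augm_exact; exists p. Qed.

Definition chain_family (F : forall l m, hom (P l) (Q m)) :=
  forall l m p, diff Q m (F l.+1 m.+1 p) = F l m (diff P l p).

(** The components [F (m + d) m] form a chain map of degree [d] which lifts a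
    coboundary.  Lifting the coboundary's primitive to [Q 0] makes it lift
    zero, and then it is homotopic to zero. *)
Lemma chain_family_coboundary (F : forall l m, hom (P l) (Q m)) :
  chain_family F -> (forall l, coboundary (mkhom (augm Q \o F l 0))) ->
  forall l m (g : hom (Q m) N), (m <= l)%N ->
  (forall q, g (diff Q m q) = 0) -> coboundary (hcomp g (F l m)).
Proof.
move=> chainF augF l m g /subnK <-; move: (l - m)%N => d {l} gd; rewrite addnC.
have [e [augm_e e_diff e_cob]] : exists e : {linear P d -> Q 0},
  [/\ forall p, augm Q (e p) = augm Q (F d 0 p), forall p, e (diff P d p) = 0
    & forall h : hom (Q 0) N, coboundary (mkhom (h \o e))].
  case: d => [|d].
    exists (\0 : {linear P 0 -> Q 0}); split=> [p|//|h].
      have /coboundary0/(congr1 (fun f : hom _ _ => f p)) /= -> := augF 0.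
      by rewrite linear0.
    by apply/coboundary0/homE => p /=; rewrite linear0.
  have /coboundaryS[u uE] := augF d.+1.
  have [v vE] := lift_through_image (g := augm Q) (h := u) (@res_proj _ _ _ P d)
    (fun p => augm_surj Q (u p)).
  exists (v \o diff P d); split=> [p|p|h] /=; first by rewrite vE /= -uE.
    by rewrite diff2 linear0.
  by apply/coboundaryS; exists (mkhom (h \o v)).
have [||||||s [s0 sS]] := @null_homotopy _ _ (fun j => P (j + d)) Q (fun j => diff P (j + d))
  (diff Q) _ _ _ (fun j => F (j + d) j) e.
- by move=> j; apply: res_proj.
- by move=> j p; apply: diff2.
- by move=> j q /diff_exact.
- by move=> j p; apply: chainF.
- exact: e_diff.
- by move=> p; apply/augm_exact; rewrite linearB augm_e subrr.
case: m g gd => [|m] g gd.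
  suff -> : hcomp g (F (0 + d) 0) = mkhom (g \o e) by apply: e_cob.
  by apply: homE => p /=; rewrite s0 linearD /= gd addr0.
apply/coboundaryS; exists (mkhom (g \o s m)) => p /=.
by rewrite sS linearD /= gd addr0.
Qed.

(** The conditions of [is_lift] on which the class of a product depends. *)
Definition lifts (f : forall l, hom (P l) T) (F : forall l m, hom (P l) (Q m)) :=
  (forall l p, augm Q (F l 0 p) = f l p) /\ chain_family F.

Definition prod_cochain (g : forall m, hom (Q m) N) (F : forall l m, hom (P l) (Q m)) l :
  hom (P l) N := \sum_(m < l.+1) hcomp (g m) (F l m).

Lemma prod_cochainE g F l p : prod_cochain g F l p = \sum_(m < l.+1) g m (F l m p).
Proof. by rewrite hom_sumE. Qed.
End Comparison.

Section Product.
Variables (k : fieldType) (A : algType k) (I : finType).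
Variables (S : I -> lmodType A) (P : forall x, proj_resolution (S x)).
Local Notation E := (Exts P).
Local Notation "g \y f" := (@yoneda_comp _ _ _ _ P _ _ _ g f) (at level 40).

Definition cochains x y (f : E x y) (f' : forall l, hom (P x l) (S y)) :=
  forall l, represents (f' l) (f l).

(** The product may be computed with any cocycles and any lift.
    Changing the cocycles of [g] adds coboundaries, because [F] commutes with
    the differentials; changing those of [f] or the lift [F] does too, by
    [chain_family_coboundary]. *)
Lemma yoneda_represents x y z (g : E y z) (f : E x y) g' f' F :
  cochains g g' -> cochains f f' -> lifts f' F ->
  cochains (g \y f) (prod_cochain g' F).
Proof.
move=> gg' ff' [augF chainF] l.
have [augL _ chainL _] := lift_ofP f; set L := lift_of f in augL chainL.
pose g0 m : hom (P y m) (S z) := val (cocycle_of g m).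
have gg0 : cochains g g0.
  by move=> m; rewrite -(cocycle_ofK g m); apply: represents_cocycle.
have ff0 : cochains f (fun l => val (cocycle_of f l)).
  by move=> m; rewrite -(cocycle_ofK f m); apply: represents_cocycle.
(* g0 and L are the choices made in the definition of the product *)
have LR : represents (prod_cochain g0 L l) ((g \y f) l).
  exact: (represents_cocycle (prod_cocycle g f l)).
have cF p : prod_cochain g' F l (diff (P x) l p) = 0.
  rewrite prod_cochainE big1 // => m _; rewrite -chainF; exact: represents_diff (gg' m).
have [e Fe] := cocycle_represents cF.
suff /(represents_cobound Fe LR) <- : coboundary (prod_cochain g' F l - prod_cochain g0 L l) by [].
have -> : prod_cochain g' F l - prod_cochain g0 L l =
    \sum_(m < l.+1) (hcomp (g' m) (F l m - L l m) + hcomp (g' m - g0 m) (L l m)).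
  rewrite -sumrB; apply: eq_bigr => m _; apply: homE => p.
  by rewrite homD_E !hcompE !homB_E !hcompE linearB addrA subrK.
apply: rpred_sum => m _; apply: rpredD.
  apply: (chain_family_coboundary (F := fun l m => F l m - L l m)).
  - by move=> l' m' p; rewrite !homB_E linearB chainF chainL.
  - move=> l'; have := (represents_cobound (ff' l') (ff0 l')).1 erefl.
    congr (_ (coboundary _)); apply: homE => p.
    by rewrite homB_E -augF -augL -linearB.
  - by rewrite -ltnS.
  - by move=> q; apply: represents_diff (gg' m).
case: m => -[|m] ml /=.
  have /coboundary0 -> := (represents_cobound (gg' 0) (gg0 0)).1 erefl.
  suff -> : hcomp 0 (L l 0) = 0 :> hom (P x l) (S z) by apply: rpred0.
  exact: homE.
have /coboundaryS[t tE] := (represents_cobound (gg' m.+1) (gg0 m.+1)).1 erefl.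
case: l ml {LR cF e Fe} => // l ml.
apply/coboundaryS; exists (hcomp t (L l m)) => p.
by rewrite !hcompE tE chainL.
Qed.

Definition bounded x y (f : E x y) N := forall l, (N <= l)%N -> f l = 0.

(** Cutting a lift down to the degrees where [f] lives keeps it a lift, since
    the lifting equations relate components of the same degree only. *)
Lemma bounded_lift x y (f : E x y) N : bounded f N ->
  exists (f' : forall l, hom (P x l) (S y)) (F : forall l m, hom (P x l) (P y m)),
  [/\ cochains f f', lifts f' F, forall l, (N <= l)%N -> f' l = 0
    & forall l m, ~~ (m <= l < N + m)%N -> F l m = 0].
Proof.
move=> fN; have [augF _ chainF _] := lift_ofP f.
have f0 l : (N <= l)%N -> val (cocycle_of f l) = 0.
  by move=> /fN; rewrite /cocycle_of => ->; rewrite eqxx.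
exists (fun l => val (cocycle_of f l)),
  (fun l m => if (m <= l < N + m)%N then lift_of f l m else 0).
split=> // [l||l m /negPf-> //].
  by rewrite -[X in represents _ X](cocycle_ofK f l); apply: represents_cocycle.
split=> [l p|l m p].
  by rewrite addn0 /=; case: ltnP => [_|/f0->]; rewrite ?augF ?linear0.
rewrite addnS !ltnS; case: ifP => // _; exact: linear0.
Qed.

Lemma cochains_exist x y (f : E x y) :
  exists (f' : forall l, hom (P x l) (S y)) (F : forall l m, hom (P x l) (P y m)),
  [/\ cochains f f', lifts f' F & forall l m, (l < m)%N -> F l m = 0].
Proof.
have [N fN] := dsum_fin f.
have [f' [F [ff' fF _ F0]]] := bounded_lift (N := N) fN.
by exists f', F; split=> // l m lm; apply: F0; rewrite leqNgt lm.
Qed.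

Lemma yoneda_eq x y (f g : E x y) f' g' : cochains f f' -> cochains g g' ->
  (forall l p, f' l p = g' l p) -> f = g.
Proof.
move=> ff' gg' fg; apply: dsumE => l; apply: represents_inj (ff' l) _.
by rewrite (_ : f' l = g' l) //; apply: homE => p.
Qed.

Lemma cochains_linear x y a (f g : E x y) f' g' : cochains f f' -> cochains g g' ->
  cochains (a *: f + g) (fun l => a *: f' l + g' l).
Proof. by move=> ff' gg' l; apply: represents_linear. Qed.

Lemma yoneda_linl x y z (f : E x y) : linear (fun g : E y z => g \y f).
Proof.
move=> a g h; have [[[f' [F [ff' fF _]]] [g' [_ [gg' _ _]]]] [h' [_ [hh' _ _]]]] :=
  (cochains_exist f, cochains_exist g, cochains_exist h).
apply: yoneda_eq (yoneda_represents (cochains_linear a gg' hh') ff' fF) _ _.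
  exact: cochains_linear (yoneda_represents gg' ff' fF) (yoneda_represents hh' ff' fF).
move=> l p; rewrite homD_E homZ_E !prod_cochainE scaler_sumr -big_split.
exact: eq_bigr.
Qed.

Lemma yoneda_linr x y z (g : E y z) : linear (fun f : E x y => g \y f).
Proof.
move=> a f h; have [[[f' [F [ff' [augF chF] _]]] [g' [_ [gg' _ _]]]] [h' [H [hh' [augH chH] _]]]] :=
  (cochains_exist f, cochains_exist g, cochains_exist h).
pose L l m := a *: F l m + H l m.
have fL : lifts (fun l => a *: f' l + h' l) L.
  by split=> [l p|l m p]; rewrite /L !homD_E !homZ_E linearP /= ?augF ?augH ?chF ?chH.
apply: yoneda_eq (yoneda_represents gg' (cochains_linear a ff' hh') fL) _ _.
  exact: cochains_linear (yoneda_represents gg' ff' (conj augF chF))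
    (yoneda_represents gg' hh' (conj augH chH)).
move=> l p; rewrite homD_E homZ_E !prod_cochainE scaler_sumr -big_split.
by apply: eq_bigr => m _; rewrite /L homD_E homZ_E linearP.
Qed.

Lemma yoneda_idl x y (f : E x y) : yoneda_id P y \y f = f.
Proof.
have [f' [F [ff' fF _]]] := cochains_exist f.
pose i m : hom (P y m) (S y) := if m is 0 then mkhom (augm (P y)) else 0.
have ii : cochains (yoneda_id P y) i.
  case=> [|m] /=; last exact: represents0.
  exact: (represents_cocycle (Subm (augm_cocycle P y) : cocycle _ _ 0)).
apply: yoneda_eq (yoneda_represents ii ff' fF) ff' _ => l p.
rewrite prod_cochainE big_ord_recl /= big1 ?addr0; last by [].
exact: fF.1.
Qed.

(** The lift of the identity class: equality of [l] and [m] is decided because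
    [P x l] and [P x m] are different types. *)
Definition id_family x l m : hom (P x l) (P x m) :=
  match l =P m with
  | ReflectT lm => ecast j (hom (P x l) (P x j)) lm (mkhom idfun)
  | ReflectF _ => 0
  end.

Lemma id_family_id x l p : id_family x l l p = p.
Proof. by rewrite /id_family; case: eqP => // e; rewrite (eq_irrelevance e erefl). Qed.

Lemma id_family_neq x l m : l != m -> id_family x l m = 0.
Proof. by rewrite /id_family; case: eqP. Qed.

Lemma yoneda_idr x y (f : E x y) : f \y yoneda_id P x = f.
Proof.
have [f' [_ [ff' _ _]]] := cochains_exist f.
pose i m : hom (P x m) (S x) := if m is 0 then mkhom (augm (P x)) else 0.
have ii : cochains (yoneda_id P x) i.
  case=> [|m] /=; last exact: represents0.
  exact: (represents_cocycle (Subm (augm_cocycle P x) : cocycle _ _ 0)).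
have iI : lifts i (id_family x).
  split=> [[|l] p|l m p]; first by rewrite id_family_id.
    by rewrite id_family_neq ?linear0.
  have [<-|lm] := eqVneq l m; first by rewrite !id_family_id.
  by rewrite !id_family_neq ?linear0.
apply: yoneda_eq (yoneda_represents ff' ii iI) ff' _ => l p.
rewrite prod_cochainE (bigD1 ord_max) //= big1 ?addr0 ?id_family_id // => m ml.
by rewrite id_family_neq ?linear0 // eq_sym.
Qed.

(** Composing the lifts of [g] and [f] gives a lift of the product, and both
    sides are then computed by the same double sum.  The lifts are taken with
    no components of negative degree, so that truncating the inner sum at [l]
    or at [j] makes no difference. *)
Lemma yoneda_assoc x y z w (h : E z w) (g : E y z) (f : E x y) :
  (h \y g) \y f = h \y (g \y f).
Proof.
have [[[f' [F [ff' fF F0]]] [g' [G [gg' gG G0]]]] [h' [_ [hh' _ _]]]] :=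
  (cochains_exist f, cochains_exist g, cochains_exist h).
pose GF l m := \sum_(j < l.+1) hcomp (G j m) (F l j).
have GFE l m p : GF l m p = \sum_(j < l.+1) G j m (F l j p) by rewrite hom_sumE.
have gfGF : lifts (prod_cochain g' F) GF.
  split=> [l p|l m p]; rewrite !GFE linear_sum ?prod_cochainE.
    by apply: eq_bigr => j _; apply: gG.1.
  rewrite big_ord_recl G0 // linear0 add0r; apply: eq_bigr => j _.
  by rewrite gG.2 fF.2.
apply: yoneda_eq (yoneda_represents (yoneda_represents hh' gg' gG) ff' fF)
  (yoneda_represents hh' (yoneda_represents gg' ff' fF) gfGF) _ => l p.
rewrite !prod_cochainE.
transitivity (\sum_(j < l.+1) \sum_(m < l.+1) h' m (G j m (F l j p))).
  apply: eq_bigr => j _; rewrite prod_cochainE.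
  rewrite (big_ord_widen l.+1 (fun m => h' m (G j m (F l j p))) (ltn_ord j)) big_mkcond.
  apply: eq_bigr => m _; case: ltnP => // jm.
  by rewrite G0 // linear0.
rewrite exchange_big; apply: eq_bigr => m _.
by rewrite GFE linear_sum.
Qed.

(** With lifts cut down to the degrees below [b], a nonzero term
    [g' m \o F l m] requires [m < a] and [l < b + m]. *)
Lemma yoneda_bounded x y z (g : E y z) (f : E x y) a b :
  bounded g a -> bounded f b -> bounded (g \y f) (a + b).
Proof.
move=> ga fb l abl.
have [[f' [F [ff' fF _ F0]]] [g' [_ [gg' _ g'0 _]]]] :=
  (bounded_lift fb, bounded_lift ga).
apply: represents_inj (yoneda_represents gg' ff' fF l) _.
suff -> : prod_cochain g' F l = 0 by apply: represents0.
apply: homE => p; rewrite prod_cochainE big1 // => m _.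
have [am|ma] := leqP a m; first by rewrite g'0.
rewrite F0 ?linear0 // negb_and -leqNgt; apply/orP; right.
by rewrite addnC; apply: leq_trans abl; rewrite leq_add2r ltnW.
Qed.
End Product.

(** * Finitely generated subcategories *)

Section Words.
Variables (k : fieldType) (A : algType k) (I : finType).
Variables (S : I -> lmodType A) (P : forall x, proj_resolution (S x)).
Local Notation E := (Exts P).
Local Notation "g \y f" := (@yoneda_comp _ _ _ _ P _ _ _ g f) (at level 40).

Variables (n : nat) (s t : 'I_n -> I) (g : forall i, E (s i) (t i)).

(** Products of generators, bracketed to the right, whose successive objects
    all lie in [U]. *)
Inductive word (U : {set I}) x : forall y, E x y -> Prop :=
| WordId : x \in U -> word U (yoneda_id P x)
| WordCons i (w : E x (s i)) : t i \in U -> word U w -> word U (g i \y w).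

Inductive combination x y : E x y -> Prop :=
| Comb0 : combination 0
| CombLin c (w f : E x y) : word setT w -> combination f -> combination (c *: w + f).

Lemma word_combination x y (w : E x y) : word setT w -> combination w.
Proof. by move=> ww; rewrite -[w]scale1r -[_ *: w]addr0; apply/CombLin/Comb0. Qed.

Lemma combination_linear x y c (a b : E x y) :
  combination a -> combination b -> combination (c *: a + b).
Proof.
move=> ca cb; elim: ca => [|c' w f ww _ cf]; first by rewrite scaler0 add0r.
by rewrite scalerDr scalerA -addrA; apply: CombLin.
Qed.

Lemma word_comp x y z (w : E y z) (v : E x y) :
  word setT w -> word setT v -> word setT (w \y v).
Proof.
move=> ww wv; elim: ww => [_|i u _ _ wu]; first by rewrite yoneda_idl.
by rewrite yoneda_assoc; apply: WordCons.
Qed.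

Lemma combination_comp x y z (a : E y z) (b : E x y) :
  combination a -> combination b -> combination (a \y b).
Proof.
move=> ca cb; elim: ca => [|c w f ww _ cf].
  have := yoneda_linl (z := z) b (-1) 0 0; rewrite scaler0 addr0 scaleN1r addNr => ->.
  exact: Comb0.
rewrite (yoneda_linl b); apply: combination_linear cf.
elim: cb => [|c' v f' wv _ cf'].
  have := yoneda_linr w (-1) (0 : E x y) 0; rewrite scaler0 addr0 scaleN1r addNr => ->.
  exact: Comb0.
by rewrite (yoneda_linr w); apply: combination_linear cf'; apply/word_combination/word_comp.
Qed.

Lemma generated_combination
    (F : subcategory (@KCatData k I E (yoneda_id P) (@yoneda_comp _ _ _ _ P)))
    x y (f : E x y) :
  generated F g f -> combination f.
Proof.
elim=> [i|u _|u v w a b _ ca _ cb|u v _ _|u v c a b _ ca _ cb].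
- rewrite -[g i]yoneda_idr; apply: word_combination; apply: WordCons (in_setT _) _.
  exact: WordId.
- by apply/word_combination/WordId.
- exact: combination_comp.
- exact: Comb0.
- exact: combination_linear.
Qed.

(** A word that reaches [y] is cut at its first arrival there.  What follows is
    kept as a mere morphism [h]: when the word ends in [y] this is a loop, and
    loops are bounded whatever their factors. *)
Lemma word_cut (U : {set I}) x z (w : E x z) y : word U w ->
  [\/ word (U :\ y) w, x = y | exists i (h : E (t i) z) (v : E x (s i)),
     [/\ t i = y, word (U :\ y) v & w = h \y (g i \y v)]].
Proof.
elim=> [xU|i v tU wv [wy|xy|[j [h [u [tj wu ->]]]]]].
- have [xy|xy] := eqVneq x y; first by constructor 2.
  by constructor 1; apply: WordId; rewrite !inE xy.
- have [ty|ty] := eqVneq (t i) y; last first.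
    by constructor 1; apply: WordCons; rewrite // !inE ty.
  by constructor 3; exists i, (yoneda_id P (t i)), v; rewrite yoneda_idl.
- by constructor 2.
- by constructor 3; exists j, (g i \y h), u; rewrite yoneda_assoc.
Qed.

Lemma word_target U x y (w : E x y) : word U w -> y \in U.
Proof. by case. Qed.

(** Induction on [U]: cutting a word at its target [y] splits off a loop, which
    contributes less than [N], and a generator, which contributes less than
    [d], and leaves a word that avoids [y]. *)
Lemma word_bounded N d : (forall x y (f : E x y), x = y -> bounded f N) ->
  (forall i, bounded (g i) d) ->
  forall (U : {set I}) x y (w : E x y), word U w -> bounded w (#|U| * (N + d)).
Proof.
move=> loopN gd U; move: {2}#|U| (leqnn #|U|) => u; elim: u U => [|u IHu] U Uu x y w wU.
  by have := word_target wU; move: Uu; rewrite leqn0 cards_eq0 => /eqP->; rewrite inE.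
have yU := word_target wU; have Uy : #|U| = #|U :\ y|.+1 by rewrite (cardsD1 y) yU.
have NU : (N + d <= #|U| * (N + d))%N by rewrite leq_pmull // Uy.
have [/word_target|xy|[i [h [v [ty wv ->]]]]] := word_cut y wU.
- by rewrite !inE eqxx.
- move=> l Nl; apply: (loopN _ _ _ xy); apply: leq_trans Nl; apply: leq_trans NU.
  exact: leq_addr.
rewrite Uy mulSn -addnA; apply: yoneda_bounded; first exact: loopN.
apply: yoneda_bounded (gd i) _; apply: IHu wv.
by rewrite -ltnS -Uy.
Qed.

Lemma combination_bounded D x y (f : E x y) :
  (forall x y (w : E x y), word setT w -> bounded w D) -> combination f -> bounded f D.
Proof.
move=> wD; elim=> [//|c w h ww _ hD] l Dl.
have -> : (c *: w + h) l = c *: w l + h l by [].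
by rewrite (hD l Dl) (wD _ _ _ ww l Dl) scaler0 addr0.
Qed.
End Words.

Section SubcategoryBound.
Variables (k : fieldType) (A : algType k) (I : finType).
Variables (S : I -> lmodType A) (P : forall x, proj_resolution (S x)).
Hypothesis fS : forall x, fin_dim (kspace (S x)).
Local Notation C := (@KCatData k I (Exts P) (yoneda_id P) (@yoneda_comp _ _ _ _ P)).

(** Filtering by the top degree reduces to the spaces [Ext^D]. *)
Lemma bounded_fin_dim x y (F : submodClosed (Exts P x y)) D :
  (forall f, f \in F -> bounded f D) -> fin_dim (subm F).
Proof.
elim: D F => [|D IHD] F FD.
  exists 0%N, (fun=> 0) => v; exists (fun=> 0); rewrite big_ord0; apply/val_inj/dsumE => l.
  by rewrite (FD _ (valP v)).
have ev_lin : linear (fun f : Exts P x y => f D) by [].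
pose ev := linearOf ev_lin.
pose FK : {pred Exts P x y} := fun f => (f \in F) && (f D == 0).
have FKc : submod_closed FK.
  split=> [|a f h /andP[fF /eqP fD] /andP[hF /eqP hD]]; apply/andP; split.
  - exact: rpred0.
  - exact/eqP.
  - by rewrite rpredD ?rpredZ.
  - by apply/eqP; rewrite -[LHS]/(a *: f D + h D) fD hD scaler0 addr0.
pose FKm := GRing.isSubmodClosed.Build k (Exts P x y) FK FKc.
pose FK' : submodClosed (Exts P x y) := HB.pack FK FKm.
apply: (fin_dim_ext (f := ev) (K := FK')).
- exact: Ext_fin_dim.
- by move=> f fF fD; apply/andP; split=> //; apply/eqP.
apply: IHD => f /andP[fF /eqP fD] l; rewrite leq_eqVlt => /predU1P[<- //|].
exact: FD.
Qed.

(** If all [Ext (S x) (S x)] were bounded, so would be the degrees of all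
    morphisms of a finitely generated subcategory. *)
Lemma fin_gen_infinite_loop (F : subcategory C) : inf_dim F -> fin_gen F ->
  exists x, infinite_graded (Ext (P x) (S x)).
Proof.
move=> [x0 [y0 [x0F y0F inf]]] [n [s [t [g [gF genF]]]]].
apply: contrapT => /forallNP noinf; apply: inf.
have loop x : exists N, forall l, (N <= l)%N -> forall e : Ext (P x) (S x) l, e = 0.
  have /existsNP[N HN] := noinf x; exists N => l Nl e.
  apply/eqP; apply: contrapT => /negP e0; apply: HN; exists l => //.
  by exists e.
have [Nx NxP] := choice loop; pose N := \max_x Nx x.
have loopN x y (f : Exts P x y) : x = y -> bounded f N.
  move=> xy; case: _ / xy f => f l Nl; apply: NxP; apply: leq_trans Nl.
  exact: leq_bigmax.
have /choice[dg dgP] i : exists d, bounded (g i) d by apply: dsum_fin.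
pose d := \max_i dg i.
have gd i : bounded (g i) d.
  by move=> l dl; apply: dgP; apply: leq_trans dl; apply: leq_bigmax.
apply: (@bounded_fin_dim _ _ _ (#|[set: I]| * (N + d))) => f fF.
apply: (combination_bounded (word_bounded loopN gd (U := setT))).
exact: generated_combination (genF _ _ _ x0F y0F fF).
Qed.
End SubcategoryBound.

(** * Change of resolution, and Tor against Ext *)

Section Independence.
Variables (k : fieldType) (A : algType k) (M N : lmodType A).

Lemma Ext_nonzeroP (P : proj_resolution M) n :
  nonzero (Ext P N n) <->
  exists2 c : hom (P n) N, forall p, c (diff P n p) = 0 & ~ coboundary c.
Proof.
split=> [[e /eqP e0]|[c c0 nc]].
  have [c ce] := represents_exists e; exists c => [p|cc]; first exact: represents_diff ce.
  by apply: e0; apply/(represents_cobound ce (represents0 _ _ _)); rewrite subr0.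
have [e ce] := cocycle_represents c0; exists e; apply/eqP => e0; apply: nc.
by rewrite -[c]subr0; apply: (represents_cobound ce (represents0 _ _ _)).1.
Qed.

Lemma identity_lift (P Q : proj_resolution M) :
  exists F : forall n, hom (P n) (Q n),
    (forall p, augm Q (F 0 p) = augm P p) /\
    (forall n p, diff Q n (F n.+1 p) = F n (diff P n p)).
Proof.
have aP : mkhom (augm P) \in kerp (codiff P M 0).
  by apply/eqP/homE => p; apply: augm_diff.
pose f l : cocycle M P l := if l is 0 then Subm aP else 0.
have [|F [augF _ dF _]] := @lift_exists _ _ _ _ P Q f 1; first by case.
by exists (fun n => F n n); split=> [p|n p]; [apply: augF | apply: dF].
Qed.

(** The composite of the lifts [P -> Q -> P] of the identity is homotopic to the
    identity, so a cocycle on [P] whose transfer to [Q] is a coboundary is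
    itself one. *)
Lemma Ext_independent (P Q : proj_resolution M) n :
  nonzero (Ext P N n) -> nonzero (Ext Q N n).
Proof.
move=> /Ext_nonzeroP[c c0 nc].
have [F [augF dF]] := identity_lift P Q; have [G [augG dG]] := identity_lift Q P.
apply/Ext_nonzeroP; exists (hcomp c (G n)) => [q|cG]; first by rewrite hcompE -dG c0.
have lin j : linear (fun p : P j => G j (F j p) - p).
  by move=> a p q; rewrite !linearP scalerDr addrACA.
have [||||||s [s0 sS]] := @null_homotopy _ _ P P (diff P) (diff P) _ _ _
  (fun j => linearOf (lin j)) \0.
- exact: res_proj.
- exact: diff2.
- by move=> j q /diff_exact.
- by move=> j p /=; rewrite linearB dG dF.
- by [].
- by move=> p /=; apply/augm_exact; rewrite subr0 linearB augG augF subrr.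
apply: nc; case: n c c0 cG => [|n] c c0 cG.
  apply/coboundary0/homE => p; have := congr1 c (s0 p).
  rewrite /= add0r c0 linearB /=.
  have /coboundary0/(congr1 (fun f : hom _ _ => f (F 0 p))) := cG.
  by rewrite hcompE => ->; rewrite sub0r => /eqP; rewrite oppr_eq0 => /eqP.
have /coboundaryS[t tE] := cG.
apply/coboundaryS; exists (hcomp t (F n) - hcomp c (mkhom (s n))) => p.
have := congr1 c (sS n p); rewrite /= linearB linearD /= c0 addr0.
rewrite -[c (G _ _)]/(hcomp c (G n.+1) _) tE dF => /eqP.
by rewrite subr_eq addrC -subr_eq => /eqP<-.
Qed.
End Independence.

Section QuotientLift.
Variables (R : pzRingType) (U V : lmodType R) (K : submodClosed U) (f : {linear U -> V}).

Lemma quotm_lift : (forall x, x \in K -> f x = 0) ->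
  exists g : {linear quotm K -> V}, forall x, g (clsm K x) = f x.
Proof.
move=> fK; pose g (q : quotm K) := f (repm q).
have gE x : g (clsm K x) = f x.
  apply/eqP; rewrite -subr_eq0 -linearB; apply/eqP/fK/clsm_eqP; exact: repmK.
have lin : linear g.
  by move=> a q r; rewrite -[q]repmK -[r]repmK -linearP !gE linearP.
by exists (linearOf lin).
Qed.
End QuotientLift.

Section Tensor.
Variables (k : fieldType) (A : algType k) (X : lmodType A^c) (M : lmodType A).

Definition pure (x : X) (m : M) : tens X M := clsm _ (pure_free x m).

Lemma pure_rel (u v : tens_free X M) : tens_rel (u - v) ->
  clsm (spanp (@tens_rel _ _ X M)) u = clsm _ v.
Proof. by move=> ruv; apply/clsm_eqP/asboolP => N; apply. Qed.

Lemma pureDr x m m' : pure x (m + m') = pure x m + pure x m'.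
Proof.
by rewrite /pure -raddfD; apply: pure_rel; rewrite opprD addrA; apply: TensAddr.
Qed.
Lemma pureZ (c : k) x m : pure x (c%:A *: m) = c *: pure x m.
Proof. by rewrite /pure -linearZ; apply: pure_rel; apply: TensScale. Qed.
Lemma pure_bal x (a : A) m : pure ((a : A^c) *: x) m = pure x (a *: m).
Proof. by apply: pure_rel; apply: TensBal. Qed.

Lemma tens_ind (H : tens X M -> Prop) :
  H 0 -> (forall c x m u, H u -> H (c *: pure x m + u)) -> forall u, H u.
Proof.
move=> H0 HD u; rewrite -[u]repmK -[repm u]freeg_sumE raddf_sum.
elim/big_rec: _ => //= -[x m] v _ Hv; set c := coeff _ _.
suff -> : << c *g (x, m) >> = c *: pure_free x m by rewrite linearZ_LR; apply: HD.
by apply/eqP/freeg_eqP => q; rewrite coeffZ !coeffU mul1r.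
Qed.

Lemma tens_lift (V : lmodType k) (f : X -> M -> V) :
  (forall x y m, f (x + y) m = f x m + f y m) ->
  (forall x m n, f x (m + n) = f x m + f x n) ->
  (forall x (a : A) m, f ((a : A^c) *: x) m = f x (a *: m)) ->
  (forall (c : k) x m, f x (c%:A *: m) = c *: f x m) ->
  exists g : {linear tens X M -> V}, forall x m, g (pure x m) = f x m.
Proof.
move=> fDl fDr fB fZ; pose f2 (xm : X * M) := f xm.1 xm.2.
have [u|g gE] := @quotm_lift _ _ _ (spanp (@tens_rel _ _ X M)) (fglift f2); last first.
  by exists g => x m; rewrite gE /= fglift1.
move=> /asboolP/(_ (kerp (fglift f2) : submodClosed _)) => K; apply/eqP/K => v rv; apply/eqP.
case: rv => [x y m|x m m'|x a m|c x m]; rewrite !linearB ?linearZ_LR /= !fglift1 /f2 /=.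
- by rewrite fDl addrAC addrK subrr.
- by rewrite fDr addrAC addrK subrr.
- by rewrite fB subrr.
- by rewrite fZ scalerN subrr.
Qed.
End Tensor.

Lemma tens_mapE (k : fieldType) (A : algType k) (X : lmodType A^c) (M M' : lmodType A)
  (f : {linear M -> M'}) (x : X) m : tens_map (X := X) f (pure x m) = pure x (f m).
Proof. by rewrite /pure -[in RHS]free_map_pure; apply: quotm_map_cls; apply: free_map_rel. Qed.

Section SimpleModules.
Variables (k : fieldType) (L : bound_quiver_algebra k) (x : bq_vertex L).
Local Notation Sx := (lsimple x).
Local Notation kx := (rsimple x).

Lemma bq_char_scalar c : bq_char x (c%:A : L) = c.
Proof.
rewrite -(rmorph1 (bq_pi L)) -bq_pi_scalable bq_char_pi [pcoef _ _]coeffZ.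
by rewrite -[coeff _ _]/(pcoef _ 1) -bq_char_pi rmorph1 bq_char1 mulr1.
Qed.

Lemma lsimple_scaleE (a : L) (c : Sx) : a *: c = bq_char x a * (c : k).
Proof. by []. Qed.
Lemma rsimple_scaleE (a : L) (c : kx) : (a : L^c) *: c = bq_char x a * (c : k).
Proof. by []. Qed.

Lemma lsimple_fin_dim : fin_dim (kspace (Sx : lmodType L)).
Proof.
exists 1%N, (fun=> (1 : k)) => a; exists (fun=> a); rewrite big_ord1.
by apply/esym; rewrite [a *: _](lsimple_scaleE a%:A) bq_char_scalar mulr1.
Qed.

Local Notation one := (1 : k).

(** The scalars [c%:A] act on [k_x] by multiplication, and move across the
    tensor sign. *)
Lemma pure_rsimple (M : lmodType L) (a : k) (m : M) : pure (a : kx) m = a *: pure (one : kx) m.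
Proof.
rewrite -pureZ -pure_bal; congr pure.
by rewrite rsimple_scaleE bq_char_scalar mulr1.
Qed.

Lemma tens_rsimple_fin_dim (M : lmodType L) :
  fin_dim (kspace M) -> fin_dim (tens (kx : lmodType L^c) M).
Proof.
have lin : linear (pure (one : kx) : kspace M -> tens kx M).
  by move=> a m n; rewrite pureDr [a *: m]/(a%:A *: (m : M)) pureZ.
apply: (fin_dim_onto (f := linearOf lin)) => u.
elim/tens_ind: u => [|c a m u [m' <-]]; first by exists 0; rewrite linear0.
by exists ((c * a) *: (m : kspace M) + m'); rewrite linearP /= (pure_rsimple a) scalerA.
Qed.

(** Since [Hom(M, S_x)] is the dual of [k_x (x) M], the cochain complex
    computing Ext is the dual of the complex computing Tor.  If Tor vanished in
    degree [n], the form given by a cocycle would vanish on all cycles, hence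
    would factor through the differential and make the cocycle a
    coboundary. *)
Lemma Ext_Tor (M : lmodType L) (Q : proj_resolution M) n :
  nonzero (Ext Q Sx n) -> nonzero (Tor kx Q n).
Proof.
move=> /Ext_nonzeroP[c c0 nc]; apply: contrapT => tor0.
have cycle u : tdiff_out kx Q n u = 0 -> u \in imp (tdiff kx Q n).
  move=> u0; have uK : u \in kerp (tdiff_out kx Q n) by apply/eqP.
  have : clsm (bndp (tdiff kx Q n) (g := tdiff_out kx Q n)) (Subm uK) = 0.
    by apply/eqP; apply: contrapT => /negP nz; apply: tor0; eexists; exact: nz.
  by rewrite -[0](raddf0 (clsm _)) => /clsm_eqP; rewrite subr0.
have [||||g gE] := @tens_lift _ _ kx (Q n) k^o (fun a p => (a : k) * (c p : k)).
- by move=> a b p; apply: mulrDl.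
- by move=> a p q; rewrite linearD; apply: mulrDr.
- move=> a b p; rewrite linearZ /= lsimple_scaleE rsimple_scaleE.
  by rewrite mulrCA mulrA.
- move=> a b p; rewrite linearZ /= lsimple_scaleE bq_char_scalar.
  exact: mulrCA.
have g_bnd u : g (tdiff kx Q n u) = 0.
  elim/tens_ind: u => [|a b p u IH]; first by rewrite !linear0.
  by rewrite !linearP /= IH addr0 tens_mapE gE c0 mulr0 scaler0.
have g_cyc u : tdiff_out kx Q n u = 0 -> g u = 0.
  by move=> /cycle/asboolP[v <-].
apply: nc; case: n c c0 g gE g_bnd g_cyc cycle tor0 => [|n] c c0 g gE _ g_cyc _ _.
  by apply/coboundary0/homE => p; have := gE one p; rewrite g_cyc // mul1r.
have [h hE] := factor_form (tens_rsimple_fin_dim (res_fin Q n)) g_cyc.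
have lin : linear (fun p : Q n => (h (pure (one : kx) p) : Sx)).
  move=> a p q; rewrite pureDr -pure_bal linearD; congr (_ + _).
  by rewrite rsimple_scaleE mulr1 pure_rsimple linearZ.
apply/coboundaryS; exists (mkhom (linearOf lin)) => p /=.
by rewrite -tens_mapE -hE gE mul1r.
Qed.
End SimpleModules.

(** * Morphisms to the translate of a syzygy *)

Section DualBasis.
Variables (k : fieldType) (A : algType k) (P : lmodType A).

Lemma dual_basis : projective P -> fin_dim (kspace P) ->
  exists m (e : 'I_m -> P) (xi : 'I_m -> hom P A^o),
    forall p, p = \sum_i (xi i p : A) *: e i.
Proof.
move=> projP [m [e eP]].
pose f (r : {ffun 'I_m -> A^o}) : P := \sum_i (r i : A) *: (e i : P).
have f_lin : linear f.
  move=> a r s; rewrite /f scaler_sumr -big_split; apply: eq_bigr => i _.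
  by rewrite !ffunE scalerDl scalerA.
have [|h hE] := projP _ _ (linearOf f_lin) idfun.
  move=> p; have [c ->] := eP p; exists [ffun i => (c i)%:A].
  by apply: eq_bigr => i _; rewrite ffunE.
have xi_lin i : linear (fun p => h p i : A^o).
  by move=> a p q; rewrite linearP !ffunE.
by exists m, e, (fun i => mkhom (linearOf (xi_lin i))) => p; rewrite -[LHS]hE.
Qed.
End DualBasis.

Section TauHom.
Variables (k : fieldType) (A : algType k) (P1 P0 X : lmodType A).
Variable d : {linear P1 -> P0}.

Fact rank_one_subproof (P : lmodType A) (xi : hom P A^o) (x : X) :
  linear (fun p => (xi p : A) *: x).
Proof. by move=> a p q; rewrite linearP scalerDl scalerA. Qed.
Definition rank_one (P : lmodType A) (xi : hom P A^o) (x : X) : hom P X :=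
  mkhom (linearOf (rank_one_subproof xi x)).

(** A form [theta] on Hom(P1, X) that kills the maps factoring through [d]
    sends [x] to the form [xi |-> theta (xi(-) x)] on the cokernel of the dual
    of [d]; by the dual basis of [P1] these forms do not all vanish. *)
Lemma hom_to_tau (f : hom P1 X) :
  projective P1 -> fin_dim (kspace P1) -> fin_dim (kspace X) ->
  (forall h : hom P0 X, ~ forall p, f p = h (d p)) ->
  exists (F : hom X (dual (@conv_id k A) (coker (rdual_map d)))) x u, dual_fun (F x) u != 0.
Proof.
move=> projP fP fX nf.
have nfI : f \notin imp (pullback (N := X) d).
  by apply/asboolP => -[h hf]; apply: (nf h) => p; rewrite -hf.
have [theta th0 thf] := separating_form (hom_fin_dim fP fX) nfI.
pose b (xi : rdual P1) x : k := theta (rank_one xi x).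
have b_ker xi x : xi \in imp (rdual_map d) -> b xi x = 0.
  move=> /asboolP[eta <-]; apply: th0; apply/asboolP.
  by exists (rank_one eta x); apply: homE.
have bDl xi eta x : b (xi + eta) x = b xi x + b eta x.
  rewrite /b -(linearD theta); congr (theta _); apply: homE => p.
  by rewrite homD_E /= scalerDl.
have bDr xi x y : b xi (x + y) = b xi x + b xi y.
  rewrite /b -(linearD theta); congr (theta _); apply: homE => p.
  by rewrite homD_E /= scalerDr.
have b_bal (a : A) (xi : rdual P1) x : b ((a : A^c) *: xi) x = b xi (a *: x).
  rewrite /b; congr (theta _); apply: homE => p /=.
  by rewrite scalerA.
have bZ c xi x : b xi (c%:A *: x) = c * b xi x.
  rewrite /b -[RHS](linearZ_LR theta); congr (theta _); apply: homE => p.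
  by rewrite homZ_E /= !scalerA -scalerAl -scalerAr mul1r mulr1.
pose F x (u : coker (rdual_map d)) : k := b (repm u) x.
have FE x xi : F x (clsm _ xi) = b xi x.
  rewrite /F -[repm _](subrK xi) bDl b_ker ?add0r //.
  by apply/clsm_eqP; rewrite repmK.
have F_dual x : F x \in @dualp k A A^c (@conv_id k A) (coker (rdual_map d)).
  apply/asboolP; split=> [u v|c u]; rewrite -[u]repmK.
    by rewrite -[v]repmK -raddfD !FE bDl.
  by rewrite -linearZ_LR !FE b_bal bZ.
pose G x : dual (@conv_id k A) (coker (rdual_map d)) := Dual (F_dual x).
have G_lin : linear G.
  move=> a x y; apply: dualE => u; rewrite -[u]repmK dualD_E /=.
  by rewrite -linearZ_LR !FE b_bal bDr.
have [m [e [xi eE]]] := dual_basis projP fP.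
have thfE : theta f = \sum_i b (xi i) (f (e i)).
  rewrite -linear_sum; congr (theta _); apply: homE => p.
  by rewrite hom_sumE /= [in LHS](eE p) linear_sum; apply: eq_bigr => i _; rewrite linearZ.
have [i bi] : exists i, b (xi i) (f (e i)) != 0.
  apply/existsP; apply: contraNT thf => /existsPn z.
  by rewrite thfE big1 // => i _; apply/eqP; have := z i; rewrite negbK.
exists (mkhom (linearOf G_lin)), (f (e i)), (clsm _ (xi i : rdual P1)).
by rewrite /= FE.
Qed.
End TauHom.

Section TauSyzygy.
Variables (k : fieldType) (A : algType k).

Lemma tau_syzE n (M : lmodType A) (R : min_resolution M) :
  tau_syz n R = dual (@conv_id k A) (coker (rdual_map (diff R n))).
Proof. by elim: n M R => [//|n IHn] M R /=; rewrite IHn. Qed.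

Variables (M X : lmodType A) (R : min_resolution M).
Hypothesis fX : fin_dim (kspace X).

Lemma hom_taun_nonzero n (f : hom (R n.+1) X) :
  (forall h : hom (R n) X, ~ forall p, f p = h (diff R n p)) ->
  nonzero (hom X (taun n.+1 R)) /\ nonzero (kdual (hom X (taun n.+1 R))).
Proof.
move=> nf; rewrite /taun /= tau_syzE.
have [F [x [u Fxu]]] := hom_to_tau (@res_proj _ _ _ R n.+1) (res_fin R n.+1) fX nf.
split; first by exists F; apply: contraNneq Fxu => ->.
set T := dual _ _ in F Fxu *.
pose ev (G : hom X T) : k := dual_fun (G x) u.
have ev_dual : ev \in @dualp k k^o k (@kconv_id k) (hom X T).
  apply/asboolP; split=> [//|c G].
  rewrite /ev -[RHS](dual_act (G x) c u).
  by have -> : (c%:A : k^o) = c by exact: mulr1.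
exists (Dual ev_dual); apply: contraNneq Fxu => /(congr1 (fun phi => dual_fun phi F)) /= E.
by apply/eqP.
Qed.

(** Let [c n : Hom(R n, X) -> Hom(R n.+1, X)] be composition with the
    differential.  If both [c n] and [c n.+1]
    were onto then [c n.+1 \o c n = 0] would force [Hom(R n.+2, X) = 0]. *)
Lemma hom_taun_consecutive n : nonzero (hom (R n.+2) X) ->
  exists2 j, (n <= j)%N &
    nonzero (hom X (taun j.+1 R)) /\ nonzero (kdual (hom X (taun j.+1 R))).
Proof.
move=> [f f0].
have [[h hf]|nf] :=
  pselect (exists h : hom (R n.+1) X, forall p, f p = h (diff R n.+1 p)); last first.
  exists n.+1 => //; apply: (hom_taun_nonzero (f := f)) => h hf; by apply: nf; exists h.
exists n => //; apply: (hom_taun_nonzero (f := h)) => g gh.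
move/eqP: f0; apply; apply: homE => p.
by rewrite hf gh diff2 linear0.
Qed.
End TauSyzygy.

(** * Restriction of scalars *)

Definition resmod (A B : nzRingType) (rho : {rmorphism A -> B}) (M : lmodType B) : Type := M.

Section Restriction.
Variables (A B : nzRingType) (rho : {rmorphism A -> B}).

Section Module.
Variable M : lmodType B.
Local Notation resmod := (resmod rho M).
HB.instance Definition _ := GRing.Zmodule.on resmod.
Definition resmod_scale (a : A) (x : resmod) : resmod := rho a *: (x : M).
Fact resmod_scalerA a b x : resmod_scale a (resmod_scale b x) = resmod_scale (a * b) x.
Proof. by rewrite /resmod_scale scalerA rmorphM. Qed.
Fact resmod_scale1r : left_id 1 resmod_scale.
Proof. by move=> x; rewrite /resmod_scale rmorph1 scale1r. Qed.
Fact resmod_scalerDr : right_distributive resmod_scale +%R.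
Proof. by move=> a x y; apply: scalerDr. Qed.
Fact resmod_scalerDl x : {morph resmod_scale^~ x : a b / a + b}.
Proof. by move=> a b; rewrite /resmod_scale rmorphD; apply: scalerDl. Qed.
HB.instance Definition _ := GRing.Zmodule_isLmodule.Build A resmod
  resmod_scalerA resmod_scale1r resmod_scalerDr resmod_scalerDl.
End Module.

Lemma resmod_scaleE (M : lmodType B) a (x : resmod rho M) : a *: x = rho a *: (x : M).
Proof. by []. Qed.

Variables (M N : lmodType B) (f : {linear M -> N}).
Fact resmap_linear : linear (f : resmod rho M -> resmod rho N).
Proof. by move=> a x y; rewrite resmod_scaleE linearP. Qed.
Definition resmap : {linear resmod rho M -> resmod rho N} := linearOf resmap_linear.
End Restriction.

(** Restriction along a map making [B] a free module with basis [beta] keeps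
    projectivity: a lift is prescribed on the products of the [beta j] with a
    generating family. *)
Lemma projective_restriction (k : fieldType) (A B : algType k) (rho : {rmorphism A -> B})
    m (beta : 'I_m -> B) (kap : 'I_m -> B -> A) (P : lmodType B) :
  (forall j b c, kap j (b + c) = kap j b + kap j c) ->
  (forall j a b, kap j (rho a * b) = a * kap j b) ->
  (forall b, b = \sum_j rho (kap j b) * beta j) ->
  projective P -> fin_dim (kspace P) -> projective (resmod rho P).
Proof.
move=> kapD kapM kapE projP fP M N g f gN.
have [n [e [xi eE]]] := dual_basis projP fP.
have /choice[w wE] (ij : 'I_n * 'I_m) : exists y, g y = f (beta ij.2 *: e ij.1 : P).
  exact: gN.
pose h (p : resmod rho P) := \sum_i \sum_j kap j (xi i p) *: w (i, j).
have lin : linear h.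
  move=> a p q; rewrite /h scaler_sumr -big_split; apply: eq_bigr => i _.
  rewrite scaler_sumr -big_split; apply: eq_bigr => j _ /=.
  by rewrite resmod_scaleE linearP kapD kapM scalerDl scalerA.
exists (linearOf lin) => p /=; rewrite /h linear_sum.
transitivity (f (\sum_i (xi i p : B) *: e i : P)); last by rewrite -eE.
rewrite (linear_sum f) /=; apply: eq_bigr => i _.
rewrite [in RHS](kapE (xi i p)) scaler_suml (linear_sum f) linear_sum /=.
apply: eq_bigr => j _; rewrite linearZ_LR wE -linearZ_LR /=.
by rewrite resmod_scaleE scalerA.
Qed.

(** * The enveloping algebra over its two factors *)

(* [A^c] has the carrier of [A]; these instances keep an [A^c]-module from being
   read as a module over the algebra [A]. *)
Section OppositeAlgebra.
Variables (k : fieldType) (A : algType k).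
HB.instance Definition _ := GRing.Lmodule.copy A^c A.
Let mulc (u v : A^c) : A^c := u * v.
Fact converse_scalerAl (c : k) (u v : A^c) : c *: mulc u v = mulc (c *: u) v.
Proof. exact: (scalerAr c (v : A) (u : A)). Qed.
Fact converse_scalerAr (c : k) (u v : A^c) : c *: mulc u v = mulc u (c *: v).
Proof. exact: (scalerAl c (v : A) (u : A)). Qed.
HB.instance Definition _ := GRing.Lmodule_isLalgebra.Build k A^c converse_scalerAl.
HB.instance Definition _ := GRing.Lalgebra_isAlgebra.Build k A^c converse_scalerAr.
End OppositeAlgebra.

Section EnvelopingFactors.
Variables (k : fieldType) (A : falgType k).
Local Notation b := (@bvec k A).

Lemma etens0l (y : A) : etens (0 : A) y = 0.
Proof. by have := etens_linl y (-1) (0 : A) 0; rewrite scaler0 addr0 scaleN1r addNr. Qed.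
Lemma etens0r (y : A) : etens y (0 : A) = 0.
Proof. by have := etens_linr y (-1) (0 : A) 0; rewrite scaler0 addr0 scaleN1r addNr. Qed.
Lemma etensDl (y u v : A) : etens (u + v) y = etens u y + etens v y.
Proof. by have := etens_linl y 1 u v; rewrite !scale1r. Qed.
Lemma etensDr (y u v : A) : etens y (u + v) = etens y u + etens y v.
Proof. by have := etens_linr y 1 u v; rewrite !scale1r. Qed.
Lemma etensZl c (u y : A) : etens (c *: u) y = c *: etens u y.
Proof. by have := etens_linl y c u 0; rewrite !addr0 etens0l addr0. Qed.
Lemma etensZr c (u y : A) : etens y (c *: u) = c *: etens y u.
Proof. by have := etens_linr y c u 0; rewrite !addr0 etens0r addr0. Qed.

Definition lfactor (a : A) : env A := etens a 1.
Fact lfactor_zmod : zmod_morphism lfactor.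
Proof. by move=> u v; rewrite -scaleN1r addrC /lfactor etens_linl scaleN1r addrC. Qed.
Fact lfactor_monoid : monoid_morphism lfactor.
Proof. by split=> [//|u v]; rewrite /lfactor etensM mulr1. Qed.
HB.instance Definition _ := GRing.isZmodMorphism.Build A (env A) lfactor lfactor_zmod.
HB.instance Definition _ := GRing.isMonoidMorphism.Build A (env A) lfactor lfactor_monoid.

Definition rfactor (a : A^c) : env A := etens 1 (a : A).
Fact rfactor_zmod : zmod_morphism rfactor.
Proof. by move=> u v; rewrite -scaleN1r addrC /rfactor etens_linr scaleN1r addrC. Qed.
Fact rfactor_monoid : monoid_morphism rfactor.
Proof. by split=> [//|u v]; rewrite /rfactor etensM mulr1. Qed.
HB.instance Definition _ := GRing.isZmodMorphism.Build A^c (env A) rfactor rfactor_zmod.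
HB.instance Definition _ := GRing.isMonoidMorphism.Build A^c (env A) rfactor rfactor_monoid.

Lemma bvec_coord (a : A) : a = \sum_i coord (vbasis {:A}) i a *: b i.
Proof. exact: coord_vbasis (memvf a). Qed.

(** The right factor acts on the enveloping algebra with basis [b j (x) 1]. *)
Definition rcoord j (u : env A) : A^c := \sum_l u j l *: b l.

Lemma rcoordD j u v : rcoord j (u + v) = rcoord j u + rcoord j v.
Proof. by rewrite /rcoord -big_split; apply: eq_bigr => l _; rewrite mxE scalerDl. Qed.
Lemma rcoordZ j c u : rcoord j (c *: u) = c *: rcoord j u.
Proof. by rewrite /rcoord scaler_sumr; apply: eq_bigr => l _; rewrite mxE scalerA. Qed.

Lemma rcoord_etens j u v : rcoord j (etens u v) = coord (vbasis {:A}) j u *: (v : A).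
Proof.
rewrite [in RHS](bvec_coord v) scaler_sumr; apply: eq_bigr => l _.
by rewrite mxE scalerA.
Qed.

Lemma rcoordM j (a : A^c) u : rcoord j (rfactor a * u) = a * rcoord j u.
Proof.
elim/etens_ind: u => [u v|c u v IHu IHv].
  rewrite etensM mul1r !rcoord_etens; exact: (scalerAl _ (v : A) (a : A)).
rewrite mulrDr -scalerAr !rcoordD !rcoordZ IHu IHv mulrDr.
congr (_ + _); exact: (scalerAl _ (rcoord j u : A) (a : A)).
Qed.

Lemma rcoordE u : u = \sum_j rfactor (rcoord j u) * etens (b j) 1.
Proof.
elim/etens_ind: u => [u v|c u v IHu IHv].
  rewrite {1}(bvec_coord u) (big_morph (fun w => etens w v) (etensDl v) (etens0l v)).
  apply: eq_bigr => j _; rewrite rcoord_etens etensM mul1r mul1r etensZl.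
  exact/esym/etensZr.
rewrite {1}IHu {1}IHv scaler_sumr -big_split; apply: eq_bigr => j _ /=.
rewrite rcoordD rcoordZ rmorphD mulrDl; congr (_ + _).
by rewrite scalerAl; congr (_ * _); apply/esym/etensZr.
Qed.

Lemma projective_right (P : lmodType (env A)) :
  projective P -> fin_dim (kspace P) -> projective (resmod rfactor P).
Proof.
exact: (@projective_restriction k A^c (env A) rfactor _ (fun j => etens (b j) 1)
  (@rcoord) P rcoordD rcoordM rcoordE).
Qed.

Lemma env_scalar c : (c%:A : env A) = etens (c%:A) 1.
Proof. by rewrite etensZl. Qed.

Lemma bimod_fin_dim : fin_dim (kspace (bimod A : lmodType (env A))).
Proof.
have scE c (y : A) : c *: (y : kspace (bimod A)) = c *: y :> A.
  by rewrite -[LHS]/(bimod_scale (c%:A : env A) y) env_scalar bimod_etens mulr1 -scalerAl mul1r.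
exists (\dim {:A}), b => v; exists (fun i => coord (vbasis {:A}) i v).
by rewrite {1}(bvec_coord v); apply: eq_bigr => i _; rewrite scE.
Qed.

Lemma env_swap_scalar c (y : bimod A) :
  (env_swap (c%:A : env A) : env A) *: y = c *: (y : A) :> A.
Proof. by rewrite env_scalar env_swapE [LHS]bimod_etens mul1r -scalerAr mulr1. Qed.

Lemma bimod_dual_fin_dim : fin_dim (kspace (bimod_dual (bimod A : lmodType (env A)))).
Proof.
pose D := bimod_dual (bimod A : lmodType (env A)).
have dZ (phi : D) c (y : A) : dual_fun phi (c *: y) = c * dual_fun phi y.
  by rewrite -(dual_act phi) env_swap_scalar.
pose ev (phi : kspace D) : {ffun 'I_(\dim {:A}) -> k^o} := [ffun i => dual_fun (phi : D) (b i)].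
have lin : linear ev.
  move=> a f g; apply/ffunP => i; rewrite !ffunE dualD_E; congr (_ + _).
  exact: (dual_act (f : D)).
apply: (fin_dim_inj (f := linearOf lin)).
  move=> f g /ffunP fg; apply: dualE => y; rewrite (bvec_coord y).
  have dsum (phi : D) : dual_fun phi (\sum_i coord (vbasis {:A}) i y *: b i) =
      \sum_i coord (vbasis {:A}) i y * dual_fun phi (b i).
    rewrite (big_morph (dual_fun phi) (id1 := 0) (op1 := +%R)); last 2 first.
    - exact: dual_add.
    - by have := dZ phi 0 0; rewrite scale0r mul0r.
    by apply: eq_bigr => i _; apply: dZ.
  by rewrite !dsum; apply: eq_bigr => i _; have := fg i; rewrite /= !ffunE => ->.
apply: fin_dim_ffun; exists 1%N, (fun=> (1 : k)) => c; exists (fun=> c).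
by rewrite big_ord1; apply/esym/mulr1.
Qed.
End EnvelopingFactors.

(** * Bimodule resolutions and resolutions of the simple modules *)

Lemma clsmZ (R : pzRingType) (M : lmodType R) (N : submodClosed M) a x :
  clsm N (a *: x) = a *: clsm N x.
Proof. exact: clsm_scale. Qed.

Section SimpleResolution.
Variables (k : fieldType) (L : bound_quiver_algebra k) (x : bq_vertex L).
Local Notation chi := (bq_char x).
Local Notation Sx := (lsimple x : lmodType L).
Local Notation b := (@bvec k L).

Let bq_charD := @bq_charD k L x.

Lemma bq_charZ c (a : L) : chi (c *: a) = c * chi a.
Proof. by rewrite -[a in LHS]mul1r scalerAl bq_charM bq_char_scalar. Qed.
Lemma bq_char0 : chi 0 = 0.
Proof. by rewrite -(scale0r 0) bq_charZ mul0r. Qed.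

(** The algebra map [u (x) v |-> chi v u]; restriction along it lets the right
    factor act on a left module through the character of [x]. *)
Definition rchar (u : env L) : L := \sum_i \sum_j (u i j * chi (b j)) *: b i.

Lemma rchar_linear : linear rchar.
Proof.
move=> c u v; rewrite /rchar scaler_sumr -big_split; apply: eq_bigr => i _ /=.
rewrite scaler_sumr -big_split; apply: eq_bigr => j _ /=.
by rewrite scalerA -scalerDl !mxE mulrDl mulrA.
Qed.
Lemma rchar_etens u v : rchar (etens u v) = chi v *: u.
Proof.
rewrite {2}(bvec_coord u) scaler_sumr; apply: eq_bigr => i _.
rewrite {2}(bvec_coord v) (big_morph chi bq_charD bq_char0).
rewrite scalerA mulr_suml scaler_suml; apply: eq_bigr => j _.
by rewrite bq_charZ mxE -mulrA [in RHS]mulrC.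
Qed.

Fact rchar_zmod : zmod_morphism rchar.
Proof. by move=> u v; rewrite -scaleN1r addrC rchar_linear scaleN1r addrC. Qed.
Fact rchar_monoid : monoid_morphism rchar.
Proof.
split=> [|u v]; first by rewrite rchar_etens bq_char1 scale1r.
have mulDl (u1 u2 w : env L) c : (c *: u1 + u2) * w = c *: (u1 * w) + u2 * w.
  by rewrite mulrDl scalerAl.
have mulDr (u1 u2 w : env L) c : w * (c *: u1 + u2) = c *: (w * u1) + w * u2.
  by rewrite mulrDr scalerAr.
elim/etens_ind: u => [u u'|c u1 u2 IH1 IH2]; last first.
  by rewrite mulDl !rchar_linear IH1 IH2 mulrDl scalerAl.
elim/etens_ind: v => [v v'|c v1 v2 IH1 IH2]; last first.
  by rewrite mulDr !rchar_linear IH1 IH2 mulrDr scalerAr.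
by rewrite etensM !rchar_etens bq_charM -scalerAl -scalerAr scalerA mulrC.
Qed.
HB.instance Definition _ := GRing.isZmodMorphism.Build (env L) L rchar rchar_zmod.
HB.instance Definition _ := GRing.isMonoidMorphism.Build (env L) L rchar rchar_monoid.

Local Notation twist := (resmod rchar).

Lemma twist_etens (M : lmodType L) u v (m : twist M) :
  etens u v *: m = (chi v *: u) *: (m : M).
Proof. by rewrite resmod_scaleE /= rchar_etens. Qed.

Section KillRight.
Variable R : lmodType (env L).
Local Notation Rl := (resmod (@lfactor k L) R).

(** The elements [b j - chi (b j)] span the kernel of the character, so the
    image of this map is the product of [R] with that ideal on the right. *)
Definition bker j : L := b j - (chi (b j))%:A.

Lemma chi_bker j : chi (bker j) = 0.
Proof. by rewrite /bker -scaleNr bq_charD bq_char_scalar addrN. Qed.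

Definition rker_map (p : {ffun 'I_(\dim {:L}) -> Rl}) : Rl :=
  \sum_j etens 1 (bker j) *: (p j : R).
Fact rker_map_linear : linear rker_map.
Proof.
move=> a p q; rewrite /rker_map scaler_sumr -big_split; apply: eq_bigr => j _ /=.
rewrite !ffunE !resmod_scaleE scalerDr; congr (_ + _).
by rewrite /= /lfactor !scalerA !etensM !mul1r !mulr1.
Qed.
HB.instance Definition _ :=
  GRing.isLinear.Build L _ Rl _ rker_map rker_map_linear.

Definition rkerp := imp rker_map.

Lemma rkerP (z : Rl) : z \in rkerp <->
  exists p : 'I_(\dim {:L}) -> R, z = \sum_j etens 1 (bker j) *: p j.
Proof.
split=> [/asboolP[p <-]|[p ->]]; first by exists p.
apply/asboolP; exists [ffun j => p j].
by apply: eq_bigr => j _; rewrite ffunE.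
Qed.

Lemma rker_act (a : L) (p : R) : chi a = 0 -> etens 1 a *: p \in rkerp.
Proof.
move=> a0; pose co j := coord (vbasis {:L}) j a.
have aE : a = \sum_j co j *: bker j.
  rewrite (eq_bigr (fun j => co j *: b j - (co j * chi (b j))%:A)); last first.
    by move=> j _; rewrite scalerBr scalerA.
  rewrite sumrB -bvec_coord -scaler_suml.
  suff -> : \sum_j co j * chi (b j) = chi a by rewrite a0 scale0r subr0.
  rewrite [in RHS](bvec_coord a) (big_morph chi bq_charD bq_char0).
  by apply: eq_bigr => j _; rewrite bq_charZ.
apply/rkerP; exists (fun j => (co j)%:A *: p).
rewrite {1}aE (big_morph (etens 1) (etensDr 1) (etens0r 1)).
rewrite scaler_suml; apply: eq_bigr => j _.
by rewrite etensZr scalerA -scalerAr mulr1.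
Qed.

Lemma rker_char (a : L) (p : R) : etens 1 a *: p - (chi a)%:A *: p \in rkerp.
Proof.
have := @rker_act (a - (chi a)%:A) p; rewrite -scaleNr bq_charD bq_char_scalar.
rewrite addrN etensDr etensZr scalerDl scaleNr scaleNr; exact.
Qed.

(** A map that kills [R m] is linear for the twisted right action, since
    right multiplication by [a] agrees with [chi a] modulo [R m]. *)
Lemma twist_of_quot_linear (M : lmodType L) (c : {linear quotm rkerp -> M}) :
  linear (fun p : R => (c (clsm rkerp (p : Rl)) : twist M)).
Proof.
have cD (p q : R) : c (clsm rkerp (p + q : Rl)) = c (clsm rkerp p) + c (clsm rkerp q).
  by rewrite raddfD linearD.
have cZ (a : L) (p : R) : c (clsm rkerp (etens a 1 *: p : Rl)) = a *: c (clsm rkerp p).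
  by rewrite -(linearZ_LR c) -clsmZ.
move=> a p q; rewrite cD; congr (_ + _).
elim/etens_ind: a => [u v|e u v IHu IHv].
  rewrite twist_etens -[in LHS](mulr1 u) -[in LHS](mul1r v).
  rewrite -[X in etens _ X](mulr1 (1 * v)) mul1r -etensM -scalerA cZ.
  have /clsm_eqP -> := rker_char v p; rewrite env_scalar cZ scalerA.
  by rewrite -scalerAr mulr1.
have E (w : env L) : e *: w = etens (e%:A) 1 * w by rewrite -env_scalar -scalerAl mul1r.
rewrite !scalerDl cD IHv; congr (_ + _).
by rewrite E -!scalerA cZ IHu twist_etens bq_char1 scale1r.
Qed.

Lemma twist_kills (M : lmodType L) (h : {linear R -> twist M}) z : z \in rkerp -> h z = 0.
Proof.
move=> /rkerP[p ->]; rewrite linear_sum big1 // => j _.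
by rewrite linearZ_LR twist_etens chi_bker scale0r [LHS]scale0r.
Qed.

Lemma twist_linear (M : lmodType L) (h : {linear R -> twist M}) : linear (h : Rl -> M).
Proof.
by move=> a p q; rewrite resmod_scaleE linearP /= /lfactor twist_etens bq_char1 scale1r.
Qed.

(** Maps from [R / R m] to [M], where [m] is the kernel of the character, are
    the bimodule maps from [R] to the twist of [M], which can be lifted. *)
Lemma projective_quot : projective R -> projective (quotm rkerp).
Proof.
move=> projR M N g f gN.
have [h hE] := projR _ _ (resmap rchar g) (linearOf (twist_of_quot_linear f)) gN.
have [h' h'E] := quotm_lift (f := linearOf (twist_linear h)) (@twist_kills M h).
by exists h' => q; rewrite -[q]repmK h'E; apply: hE.
Qed.

Lemma quot_fin_dim : fin_dim (kspace R) -> fin_dim (kspace (quotm rkerp)).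
Proof.
have lin : linear (fun p : kspace R => clsm rkerp (p : Rl) : kspace (quotm rkerp)).
  move=> a p q; rewrite -[X in _ = X + _]/(a%:A *: (clsm rkerp (p : Rl))).
  rewrite -clsmZ -raddfD; congr (clsm _ (_ + _)).
  by rewrite [RHS]resmod_scaleE /= /lfactor -env_scalar.
by apply: (fin_dim_onto (f := linearOf lin)) => q; exists (repm q); apply: repmK.
Qed.
End KillRight.
Arguments rkerp : clear implicits.

Lemma rker_diff (R R' : lmodType (env L)) (f : {linear R -> R'}) z :
  z \in rkerp R -> f z \in rkerp R'.
Proof.
move=> /rkerP[p ->]; apply/rkerP; exists (fun j => f (p j)).
by rewrite linear_sum; apply: eq_bigr => j _; rewrite linearZ.
Qed.

Lemma rker_right (R R' : lmodType (env L))
    (f : {linear resmod (@rfactor k L) R -> resmod (@rfactor k L) R'}) z :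
  z \in rkerp R -> f z \in rkerp R'.
Proof.
move=> /rkerP[p ->]; apply/rkerP; exists (fun j => f (p j)).
rewrite (linear_sum f); apply: eq_bigr => j _.
exact: (linearZ_LR f (bker j : L^c)).
Qed.

Section Resolution.
Variable R : proj_resolution (bimod L : lmodType (env L)).
Local Notation Rr n := (resmod (@rfactor k L) (R n)).
Local Notation Rl n := (resmod (@lfactor k L) (R n)).

(** As right modules all terms of the resolution, and [L] itself, are
    projective, so the augmented resolution splits.  The identity is homotopic
    to the map that factors through the augmentation by [1 |-> r]. *)
Lemma right_contraction : exists (r : R 0) (s : forall n, {linear Rr n -> Rr n.+1}),
  [/\ augm R r = 1,
      forall p : R 0, p = etens 1 (augm R p : L) *: r + diff R 0 (s 0 p)
    & forall n (p : R n.+1), p = s n (diff R n p) + diff R n.+1 (s n.+1 p)].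
Proof.
have [r r1] := augm_surj R 1.
have augm_act a (p : R 0) : augm R (etens 1 a *: p) = (augm R p : L) * a.
  by rewrite linearZ [LHS]bimod_etens mul1r.
have e_lin : linear (fun p : Rr 0 => (etens 1 (augm R p : L) *: r : Rr 0)).
  move=> a p q; rewrite !resmod_scaleE linearD /= augm_act etensDr scalerDl.
  by congr (_ + _); rewrite scalerA /rfactor etensM mul1r.
have [||||||s [s0 sS]] := @null_homotopy k L^c (fun n => Rr n) (fun n => Rr n)
  (fun n => resmap _ (diff R n)) (fun n => resmap _ (diff R n)) _ _ _
  (fun n => idfun) (linearOf e_lin).
- by move=> n; apply: projective_right; [apply: res_proj | apply: res_fin].
- by move=> n p; apply: diff2.
- by move=> n q /diff_exact.
- by [].
- by move=> p /=; rewrite augm_diff etens0r scale0r.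
- move=> p /=; apply/augm_exact; rewrite linearB augm_act r1.
  by apply/eqP; rewrite subr_eq0; apply/eqP/esym/mul1r.
by exists r, s.
Qed.

Local Notation T n := (quotm (rkerp (R n))).

(** The complex [R / R m], where [m] is the kernel of the character, is
    [R (x)_L S_x].  The contraction of [R] is right linear, so it preserves [R m]
    and shows that the quotient is exact. *)
Lemma simple_resolution : exists Q : proj_resolution Sx,
  forall n, nonzero (hom (Q n) Sx) -> nonzero (hom (R n) (twist Sx)).
Proof.
have [r [s [r1 s0 sS]]] := right_contraction.
pose dT n : {linear T n.+1 -> T n} :=
  linearOf (quotm_map_linear (f := resmap (@lfactor k L) (diff R n)) (@rker_diff _ _ (diff R n))).
have dTE n (p : R n.+1) : dT n (clsm _ (p : Rl n.+1)) = clsm _ (diff R n p : Rl n).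
  exact: (quotm_map_cls (f := resmap (@lfactor k L) (diff R n)) (@rker_diff _ _ (diff R n))).
have a_lin : linear (fun p : Rl 0 => chi (augm R p : L) : Sx).
  move=> a p q; rewrite resmod_scaleE linearP /= bq_charD; congr (_ + _).
  by rewrite [_ *: _]bimod_etens mulr1 bq_charM.
have aK z : z \in rkerp (R 0) -> linearOf a_lin z = 0.
  move=> /rkerP[p ->]; rewrite linear_sum big1 // => j _ /=.
  by rewrite linearZ [X in chi X]bimod_etens mul1r bq_charM chi_bker mulr0.
have [aT aTE] := quotm_lift aK.
have aT_surj c : exists q, aT q = c.
  exists (clsm _ (etens (c%:A) 1 *: r : Rl 0)); rewrite aTE /=.
  by rewrite linearZ [X in chi X]bimod_etens mulr1 r1 mulr1 bq_char_scalar.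
have aT_exact q : aT q = 0 <-> exists q', dT 0 q' = q.
  rewrite -[q]repmK; split=> [|[q' <-]].
    rewrite aTE => a0; exists (clsm _ (s 0 (repm q) : Rl 1)); rewrite dTE; apply/esym/clsm_eqP.
    by rewrite {1}(s0 (repm q)) addrK; apply: rker_act.
  by rewrite -[q']repmK dTE aTE /= augm_diff bq_char0.
have dT_exact n q : dT n q = 0 <-> exists q', dT n.+1 q' = q.
  rewrite -[q]repmK; split=> [|[q' <-]].
    rewrite dTE => d0; exists (clsm _ (s n.+1 (repm q) : Rl n.+2)); rewrite dTE; apply/esym/clsm_eqP.
    rewrite {1}(sS n (repm q)) addrK; apply: rker_right.
    by move: d0; rewrite -[0](raddf0 (clsm _)) => /clsm_eqP; rewrite subr0.
  by rewrite -[q']repmK dTE dTE diff2 raddf0.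
exists (@ProjResolution _ _ Sx (fun n => T n) dT aT
  (fun n => projective_quot (@res_proj _ _ _ R n)) (fun n => quot_fin_dim (res_fin R n))
  aT_surj aT_exact dT_exact) => n [c c0].
exists (mkhom (linearOf (twist_of_quot_linear c))).
apply: contraNneq c0 => /(congr1 (fun f : hom _ _ => hom_fun f)) E.
apply/eqP/homE => q; rewrite -[q]repmK.
by rewrite -[LHS]/(hom_fun (mkhom (linearOf (twist_of_quot_linear c))) (repm q)) E.
Qed.
End Resolution.

(** * Bimodule maps to the algebra and to its dual *)

(** The character presents the twist of [S_x], that is the simple bimodule at
    [(x, x)], as a quotient of [L]. *)
Lemma char_linear : linear (fun a : bimod L => (chi (a : L) : twist Sx)).
Proof.
move=> u a b'; rewrite bq_charD; congr (_ + _).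
elim/etens_ind: u => [v w|c v w IHv IHw].
  rewrite [_ *: a]bimod_etens !bq_charM twist_etens lsimple_scaleE bq_charZ.
  by rewrite mulrAC [chi w * _]mulrC.
rewrite !scalerDl bq_charD IHw; congr (_ + _).
have -> : c *: v = etens (c%:A) 1 * v by rewrite -env_scalar -scalerAl mul1r.
rewrite -!scalerA [X in chi X]bimod_etens mulr1 bq_charM IHv twist_etens bq_char1 scale1r.
by rewrite [RHS]lsimple_scaleE.
Qed.

Lemma twist_to_bimod (R : lmodType (env L)) : projective R ->
  nonzero (hom R (twist Sx)) -> nonzero (hom R (bimod L)).
Proof.
move=> projR [g g0].
have [|h hE] := projR _ _ (linearOf char_linear) g.
  by move=> c; exists (c%:A : L); apply: bq_char_scalar.
exists (mkhom h); apply: contraNneq g0 => /(congr1 (fun f : hom _ _ => hom_fun f)) E.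
apply/eqP/homE => p; rewrite -hE.
rewrite -[h p]/(hom_fun (mkhom h) p) E /=; exact: bq_char0.
Qed.

Lemma char_swap (u : env L) : chi (rchar (env_swap u)) = chi (rchar u).
Proof.
elim/etens_ind: u => [v w|c v w IHv IHw].
  by rewrite env_swapE !rchar_etens !bq_charZ mulrC.
by rewrite env_swap_lin !rchar_linear !bq_charD !bq_charZ IHv IHw.
Qed.

(** The simple bimodule embeds in the dual of [L] by [c |-> c chi]. *)
Lemma twist_to_bimod_dual (R : lmodType (env L)) :
  nonzero (hom R (twist Sx)) -> nonzero (hom R (bimod_dual (bimod L))).
Proof.
move=> [g g0].
have phi_dual p : (fun a : bimod L => (g p : k) * chi (a : L)) \in
    @dualp k (env L) (env L) (@env_swap k L) (bimod L).
  apply/asboolP; split=> [u v|c u]; first by rewrite bq_charD mulrDr.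
  by rewrite env_swap_scalar bq_charZ mulrCA.
pose h p : bimod_dual (bimod L) := Dual (phi_dual p).
have h_lin : linear h.
  move=> a p q; apply: dualE => u; rewrite dualD_E /= linearD mulrDl; congr (_ + _).
  rewrite linearZ /= resmod_scaleE lsimple_scaleE.
  have -> : chi ((env_swap a : env L) *: (u : bimod L) : L) = chi (rchar a) * chi u.
    by rewrite -char_swap; have := char_linear (env_swap a) u 0; rewrite !addr0 bq_char0 addr0.
  by rewrite mulrAC mulrC mulrCA.
exists (mkhom (linearOf h_lin)); apply: contraNneq g0 => /(congr1 (fun f : hom _ _ => hom_fun f)) E.
apply/eqP/homE => p; have : dual_fun (h p) (1 : L) = 0.
  by rewrite -[h p]/(hom_fun (mkhom (linearOf h_lin)) p) E.
by rewrite /= bq_char1 mulr1.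
Qed.
End SimpleResolution.

(** * Vertices with infinitely many self-extensions *)

Section InfiniteSelfExtensions.
Variables (k : fieldType) (L : bound_quiver_algebra k) (x : bq_vertex L).
Variable P : proj_resolution (lsimple x : lmodType L).
Hypothesis infP : infinite_graded (Ext P (lsimple x)).

Lemma idem_nonzero : exists a : L, bq_idem x * a * bq_idem x != 0.
Proof.
exists 1; rewrite mulr1; apply/eqP => e0.
have : bq_char x (bq_idem x * bq_idem x) = 1.
  by rewrite bq_charM bq_char_pi /pcoef coeffU eqxx !mulr1.
by rewrite e0 bq_char0 => /esym/eqP; rewrite oner_eq0.
Qed.

Lemma self_Tor_infinite : Tor_infinite (rsimple x) (lsimple x : lmodType L).
Proof.
move=> Q N; have [n Nn ext] := infP N; exists n => //.
exact: Ext_Tor (Ext_independent Q ext).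
Qed.

Lemma hom_twist_infinite (R : proj_resolution (bimod L : lmodType (env L))) :
  infinite_graded (fun n => hom (R n) (resmod (rchar x) (lsimple x))).
Proof.
have [Q QR] := simple_resolution x R.
move=> N; have [n Nn /(Ext_independent Q) ext] := infP N; exists n => //; apply: QR.
have /Ext_nonzeroP[c _ nc] := ext; exists c; apply/eqP => c0; apply: nc.
rewrite c0; exact: rpred0.
Qed.

Lemma tau_infinite (R : min_resolution (bimod L : lmodType (env L))) (X : lmodType (env L)) :
  fin_dim (kspace X) ->
  (forall n, nonzero (hom (R n) (resmod (rchar x) (lsimple x))) -> nonzero (hom (R n) X)) ->
  infinite_graded (fun n => hom X (taun n.+1 R)) /\
  infinite_graded (fun n => kdual (hom X (taun n.+1 R))).
Proof.
move=> fX RX.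
have tauN N : exists2 n, (N <= n)%N &
    nonzero (hom X (taun n.+1 R)) /\ nonzero (kdual (hom X (taun n.+1 R))).
  have [n Nn /RX] := hom_twist_infinite R N.+2.
  case: n Nn => [|[|n]] // Nn /(hom_taun_consecutive fX)[j nj tauj].
  by exists j => //; apply: leq_trans nj.
by split=> N; have [n Nn [t1 t2]] := tauN N; exists n.
Qed.
End InfiniteSelfExtensions.

Theorem theorem6p5 (k : fieldType) (L : bound_quiver_algebra k)
    (P : forall x : bq_vertex L, proj_resolution (lsimple x : lmodType L))
    (E : subcategory (yoneda_category P)) :
  inf_dim E -> fin_gen E ->
  inf_plus_gldim L /\ inf_coplus_gldim L /\
  forall R : min_resolution (bimod L : lmodType (env L)),
    infinite_graded (fun n => HHtau_lower R (bimod L) n.+1) /\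
    infinite_graded (fun n => HHtau_upper R (bimod L) n.+1).
Proof.
move=> infE fgE.
have [x infP] := fin_gen_infinite_loop (@lsimple_fin_dim k L) infE fgE.
have gl : (exists a : L, bq_idem x * a * bq_idem x != 0) /\
    Tor_infinite (rsimple x) (lsimple x : lmodType L).
  by split; [apply: idem_nonzero | apply: self_Tor_infinite infP].
split; [by exists x, x | split; [by exists x, x | move=> R]].
split.
  apply: (tau_infinite infP (bimod_dual_fin_dim L) (R := R) _).1 => n.
  exact: twist_to_bimod_dual.
apply: (tau_infinite infP (bimod_fin_dim L) (R := R) _).2 => n.
by apply: twist_to_bimod; apply: res_proj.
Qed.
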